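(* Let $$\mathcal{S}_{\mathcal{Q}_2}:=\left\{(U,V)\in\mathcal{U}(\mathcal{Q}_2)\times\mathcal{U}(\mathcal{Q}_2):\ V\in\mathcal{T}(U,W_U)\right\}.$$ (i) There is a one-to-one correspondence $\Xi:\mathcal{S}_{\mathcal{Q}_2}\to\operatorname{End}(\mathcal{Q}_2)$, $(U,V)\mapsto\lambda_{(U,V)}$, where $\lambda_{(U,V)}: u\mapsto U,\ s_i\mapsto Vs_i$ ($i=1,2$). (ii) $\mathcal{S}_{\mathcal{Q}_2}$ has a monoid structure with identity $(u,I)$, which makes $\Xi$ in (i) a monoid isomorphism. (iii) $\lambda_{(U,V)}\in\operatorname{End}(\mathcal{Q}_2)$ is an automorphism if and only if both $u$ and $V$ belong to $\lambda_{(U,V)}(\mathcal{Q}_2)$.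
   Context: The 2-adic ring $C^*$-algebra $\mathcal{Q}_2$ is the universal unital $C^*$-algebra generated by a unitary $u$ and an isometry $s_2$ with $s_2u=u^2s_2$ and $s_2s_2^*+us_2s_2^*u^*=1$. Put $s_1:=us_2$, and let $I$ denote the unit. $\mathcal{U}(\mathcal{Q}_2)$ is the unitary group of $\mathcal{Q}_2$, and $\operatorname{End}(\mathcal{Q}_2)$ is the set of unital $*$-endomorphisms of $\mathcal{Q}_2$, a monoid under composition. For $U\in\mathcal{U}(\mathcal{Q}_2)$, $W_U:=s_1s_2^*+s_2Us_1^*$, which is a unitary in $\mathcal{Q}_2$. For $A,B\in\mathcal{Q}_2$, $\mathcal{T}(A,B)=\{X\in\mathcal{Q}_2: AX=XB\}$. *)

(* Defs.v *)
From HB Require Import structures.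
From mathcomp Require Import all_boot all_order all_algebra.
From mathcomp Require Import complex.
From mathcomp Require Import all_classical all_reals all_analysis.
Import numFieldNormedType.Exports.

Set Implicit Arguments.
Unset Strict Implicit.
Unset Printing Implicit Defensive.

Import Order.TTheory GRing.Theory Num.Theory.
Local Open Scope classical_set_scope.
Local Open Scope ring_scope.

(* A join of [algType] and [completeNormedModType] cannot be declared as a
   Hierarchy-Builder structure below the existing [numDomainType]; a C^*-algebra
   is therefore a Banach space equipped with a product and an involution, from
   which its carrier inherits both structures.  The zero algebra is excluded, as
   in [algType].  This is harmless for the universal property below: Q_2 is
   nonzero, and the zero algebra is a terminal object. *)
Record cstarAlgType (R : realType) := CstarAlg {
  cstar_banach : completeNormedModType R[i];
  cstar_one : cstar_banach;
  cstar_mul : cstar_banach -> cstar_banach -> cstar_banach;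
  cstar_star : cstar_banach -> cstar_banach;
  cstar_mulA : associative cstar_mul;
  cstar_mul1l : left_id cstar_one cstar_mul;
  cstar_mul1r : right_id cstar_one cstar_mul;
  cstar_mulDl : left_distributive cstar_mul +%R;
  cstar_mulDr : right_distributive cstar_mul +%R;
  cstar_one_neq0 : cstar_one != 0;
  cstar_scaleAl : forall (a : R[i]) x y,
    a *: cstar_mul x y = cstar_mul (a *: x) y;
  cstar_scaleAr : forall (a : R[i]) x y,
    a *: cstar_mul x y = cstar_mul x (a *: y);
  cstar_normM_le : forall x y, `|cstar_mul x y| <= `|x| * `|y|;
  cstar_starK : involutive cstar_star;
  cstar_starD : {morph cstar_star : x y / x + y};
  cstar_starZ : forall (a : R[i]) x,
    cstar_star (a *: x) = conjc a *: cstar_star x;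
  cstar_starM : forall x y,
    cstar_star (cstar_mul x y) = cstar_mul (cstar_star y) (cstar_star x);
  cstar_norm_starM : forall x, `|cstar_mul (cstar_star x) x| = `|x| ^+ 2;
}.

Definition cstar_sort (R : realType) (A : cstarAlgType R) : Type :=
  cstar_banach A.
Coercion cstar_sort : cstarAlgType >-> Sortclass.

Section CstarInstances.
Variables (R : realType) (A : cstarAlgType R).

HB.instance Definition _ := CompleteNormedModule.on (cstar_sort A).
HB.instance Definition _ := GRing.Zmodule_isNzRing.Build (cstar_sort A)
  (@cstar_mulA R A) (@cstar_mul1l R A) (@cstar_mul1r R A)
  (@cstar_mulDl R A) (@cstar_mulDr R A) (@cstar_one_neq0 R A).
HB.instance Definition _ := GRing.Lmodule_isLalgebra.Build R[i] (cstar_sort A)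
  (@cstar_scaleAl R A).
HB.instance Definition _ := GRing.Lalgebra_isAlgebra.Build R[i] (cstar_sort A)
  (@cstar_scaleAr R A).

Definition star (x : A) : A := cstar_star x.

End CstarInstances.

Notation "x ^*" := (star x) : ring_scope.

HB.mixin Record isStarMorphism (R : realType) (A B : cstarAlgType R)
    (f : A -> B) := {
  rmorph_star : forall x : A, f x^* = (f x)^*;
}.

(* Unitality is part of [LRMorphism]; continuity is automatic. *)
#[short(type="starMorphism")]
HB.structure Definition StarMorphism (R : realType) (A B : cstarAlgType R) :=
  {f of isStarMorphism R A B f & @GRing.LRMorphism R[i] A B *:%R f}.

Section StarMorphismMonoid.
Variables (R : realType) (A : cstarAlgType R).

Fact id_star (x : A) : (idfun x^* : A) = (idfun x)^*. Proof. by []. Qed.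

HB.instance Definition _ := isStarMorphism.Build R A A idfun id_star.

Variables f g : starMorphism A A.

Fact comp_star (x : A) : (f \o g) x^* = ((f \o g) x)^*.
Proof. by rewrite /= !rmorph_star. Qed.

HB.instance Definition _ := isStarMorphism.Build R A A (f \o g) comp_star.

End StarMorphismMonoid.

Definition End (R : realType) (A : cstarAlgType R) := starMorphism A A.

Definition end_id (R : realType) (A : cstarAlgType R) : End A := idfun.

Definition end_comp (R : realType) (A : cstarAlgType R) (f g : End A) : End A :=
  f \o g.

Section TwoAdic.
Variable R : realType.
Implicit Type A : cstarAlgType R.

Definition isometric A (x : A) := x^* * x = 1.

Definition unitary A (x : A) := x^* * x = 1 /\ x * x^* = 1.

Definition Q2_relations A (u s2 : A) :=
  [/\ unitary u, isometric s2, s2 * u = u ^+ 2 * s2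
    & s2 * s2^* + u * s2 * s2^* * u^* = 1].

(* The uniqueness clause is what makes u and s2 generate A as a C^*-algebra. *)
Definition is_Q2 A (u s2 : A) :=
  Q2_relations u s2 /\
  forall (B : cstarAlgType R) (v t : B), Q2_relations v t ->
    exists! phi : starMorphism A B, phi u = v /\ phi s2 = t.

Definition Wu A (u s2 U : A) : A :=
  let s1 := u * s2 in s1 * s2^* + s2 * U * s1^*.

Definition intertwiners A (a b : A) : set A := [set x | a * x = x * b].

Definition S_Q2 A (u s2 : A) : set (A * A) :=
  [set p | [/\ unitary p.1, unitary p.2
             & intertwiners p.1 (Wu u s2 p.1) p.2]].

Definition is_lambda A (u s2 U V : A) (phi : End A) :=
  let s1 := u * s2 in
  [/\ phi u = U, phi s1 = V * s1 & phi s2 = V * s2].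

Definition automorphism A (phi : End A) := bijective phi.

End TwoAdic.

(* Main.v *)
Require Import Defs.
From HB Require Import structures.
From mathcomp Require Import all_boot all_order all_algebra.
From mathcomp Require Import complex zify ring lra.
From mathcomp Require Import all_classical all_reals all_analysis.
Import numFieldNormedType.Exports.

Set Implicit Arguments.
Unset Strict Implicit.
Unset Printing Implicit Defensive.

Import Order.TTheory GRing.Theory Num.Theory.
Local Open Scope classical_set_scope.
Local Open Scope complex_scope.
Local Open Scope ring_scope.
Local Notation "x ^*" := (star x) : ring_scope.

(** Parts (i) and (ii): a pair (v, t) satisfies the defining relations and is
    the image of (u, s2) under an endomorphism exactly when v = U and t = V s2
    with V = phi(s1) s1^* + phi(s2) s2^*, and the intertwining relation for V
    is s2 u = u^2 s2 together with s1 = u s2, transported by phi.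

    Part (iii): if u = phi(y) and V = phi(x), then s2 = phi(x^* s2), so phi is
    onto as soon as (y, x^* s2) satisfies the defining relations; this holds
    because every unital star-morphism phi from Q_2 is injective.

    Injectivity (simplicity of Q_2).  The span of the monomials
    u^a s^p s^*^q u^b is dense: its closure is a C^*-algebra, and the universal
    property retracts Q_2 onto it.  Q_2 is graded twice by Fourier analysis over
    dyadic roots of unity: by the gauge automorphisms u -> u, s -> z s, and, on
    the degree-zero part, by conjugation with the diagonal unitaries
    sum_a z^a e_a, where e_a = u^a s^m s^*^m u^-a.  Fejer's theorem shows that
    an element whose Fourier coefficients all vanish is zero.  If phi(y) = 0
    then the doubly invariant part of y vanishes: for y' in the span, a suitable
    cell r = u^b s^M gives r^* y' r = c 1, where c is any prescribed value of
    the diagonal part of y', whence |c| <= |phi(y')| <= |y' - y|.  All other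
    coefficients reduce to this one on multiplying y by powers of u, s, s^*. *)

(** * Real-valued norms *)

Section ComplexModulus.
Variable R : realType.
Implicit Types a b : R[i].

Definition cabs a : R := complex.Re `|a|.

Lemma cabsE a : `|a| = (cabs a)%:C.
Proof. by rewrite /cabs normc_def. Qed.

Lemma cabs_ge0 a : 0 <= cabs a.
Proof. by rewrite -ler0c -cabsE. Qed.

Lemma cabs_real (r : R) : cabs r%:C = `|r|.
Proof. by rewrite /cabs normc_def /= expr0n addr0 sqrtr_sqr. Qed.

Lemma cabs_sqr a : a * conjc a = (cabs a ^+ 2)%:C.
Proof. by rewrite -sqr_normc cabsE rmorphXn. Qed.

End ComplexModulus.

Section RealNorm.
Variables (R : realType) (V : normedModType R[i]).
Implicit Types (x y : V) (a : R[i]).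

(** Norms over [R[i]] take values in [R[i]]. They are real by [nrmE], so the real part loses nothing
    and gives access to the order of [R]. *)
Definition nrm x : R := complex.Re `|x|.

Lemma nrmE x : `|x| = (nrm x)%:C.
Proof.
have := normr_ge0 x; rewrite lecE => /andP[/eqP h _].
by rewrite /nrm; case: `|x| h => a b /= ->.
Qed.

Lemma nrm_ge0 x : 0 <= nrm x.
Proof. by have := normr_ge0 x; rewrite nrmE ler0c. Qed.

Lemma nrm0 : nrm 0 = 0.
Proof. by rewrite /nrm normr0. Qed.

Lemma nrm_eq0 x : (nrm x == 0) = (x == 0).
Proof. by rewrite -[RHS]normr_eq0 nrmE eq_complex /= eqxx andbT. Qed.

Lemma nrmN x : nrm (- x) = nrm x.
Proof. by rewrite /nrm normrN. Qed.

Lemma nrmD x y : nrm (x + y) <= nrm x + nrm y.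
Proof. by have := ler_normD x y; rewrite !nrmE -rmorphD lecR. Qed.

Lemma nrmB x y : nrm (x - y) <= nrm x + nrm y.
Proof. by rewrite -(nrmN y) nrmD. Qed.

Lemma nrmBC x y : nrm (x - y) = nrm (y - x).
Proof. by rewrite -nrmN opprB. Qed.

Lemma nrmZ a x : nrm (a *: x) = cabs a * nrm x.
Proof. by apply: complexI; rewrite -nrmE normrZ cabsE nrmE rmorphM. Qed.

Lemma nrm_sum (I : Type) (r : seq I) (P : pred I) (F : I -> V) :
  nrm (\sum_(i <- r | P i) F i) <= \sum_(i <- r | P i) nrm (F i).
Proof.
elim/big_rec2: _ => [|i a y _ h]; first by rewrite nrm0.
by apply: le_trans (nrmD _ _) _; rewrite lerD2l.
Qed.

Lemma nrm_small0 x : (forall e : R, 0 < e -> nrm x <= e) -> x = 0.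
Proof.
move=> h; apply/eqP; rewrite -nrm_eq0 eq_le nrm_ge0 andbT.
by apply/ler_addgt0Pl => e /h; rewrite addr0.
Qed.

End RealNorm.

Lemma nrm_cauchy (R : realType) (V : completeNormedModType R[i])
  (x : nat -> V) :
  (forall e : R, 0 < e ->
     exists N, forall n, (N <= n)%N -> nrm (x n - x N) < e) ->
  exists z, forall e : R, 0 < e ->
     exists N, forall n, (N <= n)%N -> nrm (x n - z) < e.
Proof.
move=> xC; have cx : cauchy (x @ \oo).
  apply: cauchy_exP => e e0.
  have e0' : 0 < complex.Re e by move: e0; rewrite ltcE => /andP[].
  have [N hN] := xC _ e0'; exists (x N); exists N => // n /= /hN.
  rewrite -ball_normE /ball_ /= nrmBC nrmE; move: e0; rewrite !ltcE /=.
  by move=> /andP[/eqP-> _] ->; rewrite eqxx.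
exists (lim (x @ \oo)) => e e0.
have /cvgrPdist_lt/(_ e%:C) : cvg (x @ \oo) by exact: cauchy_cvg.
rewrite ltcR => /(_ e0)[N _ hN]; exists N => n /hN /=.
by rewrite nrmE ltcR nrmBC.
Qed.

(** * Star-morphisms are contractions *)

Lemma pow_small (R : realType) (t : R) : 0 <= t < 1 ->
  forall e, 0 < e -> exists N, forall n, (N <= n)%N -> t ^+ n < e.
Proof.
move=> /andP[t0 t1] e e0.
have /cvgrPdist_lt/(_ e e0)[N _ hN] :
    (fun n => t ^+ n) @ \oo --> (0 : R) by apply: cvg_expr; rewrite ger0_norm.
by exists N => n /hN /=; rewrite sub0r normrN ger0_norm // exprn_ge0.
Qed.

Section CstarBasics.
Variables (R : realType) (A : cstarAlgType R).
Implicit Types (x y h k l : A) (a : R[i]).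

Lemma starK : involutive (@star R A). Proof. exact: cstar_starK. Qed.
Lemma starD x y : (x + y)^* = x^* + y^*. Proof. exact: cstar_starD. Qed.
Lemma starM x y : (x * y)^* = y^* * x^*. Proof. exact: cstar_starM. Qed.
Lemma starZ a x : (a *: x)^* = conjc a *: x^*. Proof. exact: cstar_starZ. Qed.

Lemma star0 : (0 : A)^* = 0.
Proof. by rewrite -(scale0r (0 : A)) starZ conjc0 !scale0r. Qed.

Lemma starN x : (- x)^* = - x^*.
Proof. by apply/eqP; rewrite -addr_eq0 -starD addNr star0. Qed.

Lemma starB x y : (x - y)^* = x^* - y^*.
Proof. by rewrite starD starN. Qed.

Lemma star1 : (1 : A)^* = 1.
Proof. by rewrite -[LHS]mul1r -[X in X * _]starK -starM mul1r starK. Qed.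

Lemma star_sum (I : Type) (r : seq I) (P : pred I) (F : I -> A) :
  (\sum_(i <- r | P i) F i)^* = \sum_(i <- r | P i) (F i)^*.
Proof. by apply: (big_morph (@star R A)); [exact: starD|exact: star0]. Qed.

Lemma nrmM x y : nrm (x * y) <= nrm x * nrm y.
Proof. by have := cstar_normM_le x y; rewrite !nrmE -rmorphM lecR. Qed.

Lemma nrm_starM x : nrm (x^* * x) = nrm x ^+ 2.
Proof. by have := cstar_norm_starM x; rewrite !nrmE -rmorphXn => /complexI. Qed.

Lemma nrm_star x : nrm x^* = nrm x.
Proof.
suff h y : nrm y <= nrm y^* by apply/eqP; rewrite eq_le h -{2}(starK x) h.
have [->|y0] := eqVneq y 0; first by rewrite star0.
have yp : 0 < nrm y by rewrite lt_def nrm_eq0 y0 nrm_ge0.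
by rewrite -(ler_pM2r yp) -expr2 -nrm_starM nrmM.
Qed.

Lemma nrm_isometric x : isometric x -> nrm x = 1.
Proof.
move=> xx.
have n1 : nrm (1 : A) = 1.
  have n0 : nrm (1 : A) != 0 by rewrite nrm_eq0 oner_neq0.
  by apply: (mulfI n0); rewrite mulr1 -expr2 -nrm_starM star1 mul1r.
have /eqP : nrm x ^+ 2 = 1 by rewrite -nrm_starM xx.
by rewrite sqrp_eq1 ?nrm_ge0 // => /eqP.
Qed.

Lemma nrm1 : nrm (1 : A) = 1.
Proof. by apply: nrm_isometric; rewrite /isometric star1 mul1r. Qed.

(* [k + i l] is a unitary of which [k] is the real part. *)
Lemma nrm_cosine k l : k^* = k -> l^* = l -> k * l = l * k ->
  k * k + l * l = 1 -> nrm k <= 1.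
Proof.
move=> ks ls kl kkll.
pose w := k + 'i%C *: l.
have sw : w^* = k - 'i%C *: l.
  rewrite starD starZ ks ls -scaleNr; congr (_ + _ *: _).
  by apply/eqP; rewrite eq_complex /= oppr0 !eqxx.
have ww : isometric w.
  rewrite /isometric sw /w mulrBl !mulrDr -!scalerAl -!scalerAr scalerA.
  by rewrite -(expr2 'i%C) sqr_i scaleN1r kl opprD opprK addrA addrK.
have -> : k = 2^-1 *: (w + w^*).
  rewrite sw addrACA subrr addr0 -mulr2n -[k *+ 2]scaler_nat scalerA.
  by rewrite mulVf ?scale1r ?pnatr_eq0.
have -> : (2^-1 : R[i]) = (2^-1)%:C by rewrite fmorphV rmorph_nat.
rewrite nrmZ cabs_real ger0_norm ?invr_ge0 //.
have := nrmD w w^*; rewrite nrm_star (nrm_isometric ww); lra.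
Qed.

(** In place of functional calculus: [g = 1 - z] works as soon as [z] is half of [h * h + z * z],
    and this fixed point is the limit of an iteration started at 0. *)
Lemma sqrt_one_minus_sqr h : h^* = h -> nrm h < 1 ->
  exists g, [/\ g^* = g, g * h = h * g & g * g = 1 - h * h].
Proof.
move=> hs h1; set b := h * h; set beta := nrm b.
have beta1 : 0 <= beta < 1.
  rewrite nrm_ge0 /=; rewrite /beta /b -{1}hs nrm_starM.
  by rewrite expr_lt1 ?nrm_ge0.
(* As [beta = 2 * t - 1] and [t < 1], the map [f] below sends the ball of radius [t] to itself, and
   by [fdist] it is [t]-Lipschitz there. *)
pose t := (1 + beta) / 2.
have t01 : 0 <= t < 1 by rewrite /t; move: beta1; lra.
pose f y := (2^-1)%:C *: (b + y * y).
have fZ (v : A) : nrm ((2^-1)%:C *: v) = nrm v / 2.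
  by rewrite nrmZ cabs_real ger0_norm ?invr_ge0 // mulrC.
have fdist y y' : nrm (f y - f y') <= (nrm y + nrm y') / 2 * nrm (y - y').
  rewrite /f -scalerBr fZ mulrAC ler_pM2r ?invr_gt0 //.
  have -> : b + y * y - (b + y' * y') = y * (y - y') + (y - y') * y'.
    by rewrite mulrBr mulrBl addrA subrK opprD addrACA subrr add0r.
  apply: le_trans (nrmD _ _) _; rewrite [leRHS]mulrDl [X in _ <= _ + X]mulrC.
  by apply: lerD; exact: nrmM.
pose y n := iter n f 0.
have yt n : nrm (y n) <= t.
  elim: n => [|n IH] /=; first by rewrite nrm0; case/andP: t01.
  rewrite /f fZ; have := nrmD b (y n * y n); have := nrmM (y n) (y n).
  have := nrm_ge0 (y n); rewrite -/beta /t in IH *; move: beta1; nra.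
have yC N (k : nat) : nrm (y (k + N)%N - y N) <= t ^+ N.
  elim: N => [|N IH].
    rewrite addn0 /= subr0 expr0; apply: le_trans (yt _) _; lra.
  rewrite addnS /= exprS; apply: le_trans (fdist _ _) _.
  apply: ler_pM => //; rewrite ?nrm_ge0 //.
    by rewrite divr_ge0 // addr_ge0 // nrm_ge0.
  have := yt N; have := yt (k + N)%N; lra.
have [z hz] : exists z, forall e : R, 0 < e ->
    exists N, forall n, (N <= n)%N -> nrm (y n - z) < e.
  apply: nrm_cauchy => e e0; have [N hN] := pow_small t01 e0.
  exists N => n Nn; rewrite -(subnK Nn).
  by apply: le_lt_trans (yC _ _) _; exact: hN.
(* Each identity for the limit [z] will follow by bounding its defect by the distances of two
   consecutive iterates from [z]. *)
have lim0 (F : A) (C : R) : 0 <= C -> 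
    (forall n, nrm F <= C * (nrm (y n - z) + nrm (y n.+1 - z))) -> F = 0.
  move=> C0 hF; apply: nrm_small0 => e e0.
  pose d := e / (2 * (C + 1)).
  have d0 : 0 < d by rewrite divr_gt0 // mulr_gt0 // ltr_wpDl.
  have de : C * (2 * d) + 2 * d = e.
    by rewrite /d; field; rewrite gt_eqF // ltr_wpDl.
  have [N hN] := hz _ d0; apply: le_trans (hF N) _.
  have pq : nrm (y N - z) + nrm (y N.+1 - z) <= 2 * d.
    by have := hN N (leqnn _); have := hN N.+1 (leqnSn _); lra.
  by have := ler_wpM2l C0 pq; clear -de d0; lra.
have ys n : (y n)^* = y n.
  elim: n => [|n IH] /=; first exact: star0.
  rewrite starZ starD starM IH /b starM hs; congr (_ *: _).
  by rewrite conjc_real.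
have yh n : y n * h = h * y n.
  elim: n => [|n IH] /=; first by rewrite mul0r mulr0.
  rewrite -/(y n) /f -scalerAl -scalerAr mulrDl mulrDr /b mulrA.
  have -> : y n * y n * h = h * (y n * y n) by rewrite -mulrA IH mulrA IH mulrA.
  by [].
have zs : z^* = z.
  apply/eqP; rewrite -subr_eq0; apply/eqP; apply: (lim0 _ 2) => // n.
  have -> : z^* - z = (y n - z) - (y n - z)^*.
    by rewrite starB ys opprB [RHS]addrC subrKA.
  have := nrmB (y n - z) (y n - z)^*; rewrite nrm_star.
  by have := nrm_ge0 (y n.+1 - z); lra.
have zh : z * h = h * z.
  apply/eqP; rewrite -subr_eq0; apply/eqP; apply: (lim0 _ 2) => // n.
  have -> : z * h - h * z = h * (y n - z) - (y n - z) * h.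
    by rewrite mulrBr mulrBl yh opprB [RHS]addrC subrKA.
  have := nrmB (h * (y n - z)) ((y n - z) * h).
  have := nrmM h (y n - z); have := nrmM (y n - z) h.
  have := nrm_ge0 (y n.+1 - z); have := nrm_ge0 (y n - z); nra.
have zt : nrm z <= 1.
  apply/ler_addgt0Pl => e e0; have [N hN] := hz _ e0.
  have := hN N (leqnn _); have := yt N; have := nrmB (y N) (y N - z).
  rewrite subKr; lra.
have fz : f z = z.
  apply/eqP; rewrite -subr_eq0; apply/eqP; apply: (lim0 _ 1) => // n.
  have -> : f z - z = (y n.+1 - z) - (f (y n) - f z).
    by rewrite /= opprB [RHS]addrC subrKA.
  have := nrmB (y n.+1 - z) (f (y n) - f z).
  have := fdist (y n) z; have := nrm_ge0 (y n - z).
  have := yt n; have := nrm_ge0 z; have := nrm_ge0 (y n); nra.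
have zz : b + z * z = z *+ 2.
  rewrite -[in RHS]fz /f -scaler_nat scalerA.
  rewrite -(rmorph_nat (real_complex R)) -rmorphM mulfV ?pnatr_eq0 //.
  by rewrite scale1r.
exists (1 - z); split.
- by rewrite starB star1 zs.
- by rewrite mulrBl mulrBr mul1r mulr1 zh.
- rewrite mulrBl mul1r mulrBr mulr1 opprB.
  have -> : z * z = z *+ 2 - b by rewrite -zz addrC addKr.
  by rewrite mulr2n [_ - b - _]addrAC addrK subrKA.
Qed.

End CstarBasics.

Section Contraction.
Variables (R : realType) (A B : cstarAlgType R) (phi : starMorphism A B).

(** A self-adjoint element of norm below 1 is the real part of a unitary by [sqrt_one_minus_sqr];
    its image is again such a real part, so it has norm at most 1. Scaling settles the self-adjoint
    case, the C*-identity the rest. *)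
Lemma starmorph_contraction x : nrm (phi x) <= nrm x.
Proof.
have sa h : h^* = h -> nrm (phi h) <= nrm h.
  move=> hs; apply/ler_addgt0Pl => e e0; set c := e + nrm h.
  have c0 : 0 < c by rewrite ltr_wpDr ?nrm_ge0.
  have cn : cabs (c^-1)%:C = c^-1.
    by rewrite cabs_real ger0_norm ?invr_ge0 // ltW.
  pose h' := (c^-1)%:C *: h.
  have hs' : h'^* = h' by rewrite starZ hs conjc_real.
  have h1 : nrm h' < 1.
    by rewrite nrmZ cn mulrC ltr_pdivrMr // mul1r /c ltrDr.
  have [g [gs gh gg]] := sqrt_one_minus_sqr hs' h1.
  have : nrm (phi h') <= 1.
    apply: (@nrm_cosine _ _ _ (phi g)); rewrite -?rmorph_star ?hs' ?gs //.
      by rewrite -!rmorphM gh.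
    by rewrite -!rmorphM -rmorphD gg addrC subrK rmorph1.
  by rewrite linearZ nrmZ cn mulrC ler_pdivrMr // mul1r.
rewrite -(@ler_pXn2r _ 2) ?nnegrE ?nrm_ge0 // -!nrm_starM.
rewrite -rmorph_star -rmorphM; apply: sa.
by rewrite starM starK.
Qed.

End Contraction.

(** * Closed star-subalgebras *)

(** The purpose is to turn the closed span of the monomials into an object to which the universal
    property applies. *)
Record cstarSub (R : realType) (A : cstarAlgType R) := CstarSub {
  sub_pred : A -> Prop;
  sub_one : sub_pred 1;
  sub_lin : forall (a : R[i]) x y,
    sub_pred x -> sub_pred y -> sub_pred (a *: x + y);
  sub_mul : forall x y, sub_pred x -> sub_pred y -> sub_pred (x * y);
  sub_star : forall x, sub_pred x -> sub_pred x^*;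
  sub_closed : forall x,
    (forall e : R, 0 < e -> exists2 y, sub_pred y & nrm (x - y) < e) ->
    sub_pred x
}.

Section SubAlgebra.
Variables (R : realType) (A : cstarAlgType R) (S : cstarSub A).

Definition sub_mem : {pred A} := fun x => `[< sub_pred S x >].

Lemma sub_memP x : reflect (sub_pred S x) (x \in sub_mem).
Proof. exact: asboolP. Qed.

Fact sub_mem_submod : submod_closed sub_mem.
Proof.
split=> [|a x y /sub_memP hx /sub_memP hy].
  apply/sub_memP; rewrite -(subrr 1) addrC -scaleN1r.
  by apply: sub_lin; exact: sub_one.
by apply/sub_memP; exact: sub_lin.
Qed.

HB.instance Definition _ := GRing.isSubmodClosed.Build R[i] A sub_mem
  sub_mem_submod.

Definition sub_sort : Type := {x : A | x \in sub_mem}.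
HB.instance Definition _ := SubChoice.on sub_sort.
HB.instance Definition _ := [SubChoice_isSubLmodule of sub_sort by <:].

Let sub_norm (x : sub_sort) : R[i] := `|val x|.

Fact sub_normD x y : sub_norm (x + y) <= sub_norm x + sub_norm y.
Proof. exact: ler_normD. Qed.

Fact sub_normZ (a : R[i]) x : sub_norm (a *: x) = `|a| * sub_norm x.
Proof. exact: normrZ. Qed.

Fact sub_norm0 x : sub_norm x = 0 -> x = 0.
Proof. by move=> /normr0_eq0 h; apply: val_inj. Qed.

HB.instance Definition _ := Lmodule_isNormed.Build R[i] sub_sort
  sub_normD sub_normZ sub_norm0.

Fact sub_complete (F : set_system sub_sort) :
  ProperFilter F -> cauchy F -> cvg F.
Proof.
move=> FF Fc.
have cG : cauchy (val @ F : set_system A).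
  apply: cauchy_exP => e e0; have [x Fx] := (cauchyP F).1 Fc e e0.
  by exists (val x); move: Fx; rewrite -!ball_normE.
have /cvg_ex[z /= zG] : cvg (val @ F : set_system A) by exact: cauchy_cvg.
have dist e : 0 < e -> \forall y \near F, `|z - val y| < e.
  by move=> e0; move/cvgrPdist_lt: zG; apply.
have Sz : z \in sub_mem.
  apply/sub_memP/sub_closed => e e0.
  have /filter_ex[y] := dist e%:C (etrans (ltcR _ _) e0).
  by rewrite nrmE ltcR => ?; exists (val y); first exact/sub_memP/valP.
apply/cvg_ex; exists (Sub z Sz : sub_sort); apply/fcvgrPdist_lt => e e0.
exact: dist.
Qed.

HB.instance Definition _ := Uniform_isComplete.Build sub_sort sub_complete.


Let one : sub_sort := Sub 1 (introT (sub_memP 1) (sub_one S)).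
Let mul (x y : sub_sort) : sub_sort := Sub (val x * val y) (introT (sub_memP _)
  (sub_mul (elimT (sub_memP _) (valP x)) (elimT (sub_memP _) (valP y)))).
Let sstar (x : sub_sort) : sub_sort :=
  Sub (val x)^* (introT (sub_memP _) (sub_star (elimT (sub_memP _) (valP x)))).

(** Kept transparent by [Defined], so that [sub_incl] respects all operations by conversion. *)
Definition sub_cstar : cstarAlgType R.
Proof.
refine (@CstarAlg R sub_sort one mul sstar _ _ _ _ _ _ _ _ _ _ _ _ _ _).
- by move=> x y z; apply: val_inj; exact: mulrA.
- by move=> x; apply: val_inj; exact: mul1r.
- by move=> x; apply: val_inj; exact: mulr1.
- by move=> x y z; apply: val_inj; exact: mulrDl.
- by move=> x y z; apply: val_inj; exact: mulrDr.
- by apply/eqP => /(congr1 val) /=; apply/eqP; exact: oner_neq0.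
- by move=> a x y; apply: val_inj; exact: scalerAl.
- by move=> a x y; apply: val_inj; exact: scalerAr.
- by move=> x y; exact: cstar_normM_le.
- by move=> x; apply: val_inj; exact: starK.
- by move=> x y; apply: val_inj; exact: starD.
- by move=> a x; apply: val_inj; exact: starZ.
- by move=> x y; apply: val_inj; exact: starM.
- by move=> x; exact: cstar_norm_starM.
Defined.

Definition sub_incl (x : sub_cstar) : A := val (x : sub_sort).

Fact sub_incl_lin : linear sub_incl. Proof. by []. Qed.
HB.instance Definition _ := GRing.isLinear.Build R[i] sub_cstar A *:%R sub_incl
  sub_incl_lin.
Fact sub_incl_mul : monoid_morphism sub_incl. Proof. by []. Qed.
HB.instance Definition _ := GRing.isMonoidMorphism.Build sub_cstar A sub_incl
  sub_incl_mul.
Fact sub_incl_star x : sub_incl x^* = (sub_incl x)^*. Proof. by []. Qed.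
HB.instance Definition _ := isStarMorphism.Build R sub_cstar A sub_incl
  sub_incl_star.

Lemma sub_incl_inj : injective sub_incl.
Proof. by move=> x y /val_inj. Qed.

Lemma sub_inclP x : sub_pred S (sub_incl x).
Proof. exact/sub_memP/(valP (x : sub_sort)). Qed.

Lemma sub_incl_surj x : sub_pred S x -> exists y, sub_incl y = x.
Proof. by move=> /sub_memP h; exists (Sub x h : sub_sort). Qed.

End SubAlgebra.

(** * Dyadic roots of unity *)

Section DyadicRoots.
Variable R : realType.

(** Root extraction starts at -1, not at 1, so that the order doubles at each stage whichever square
    root [sqrtc] selects. *)
Fixpoint dyroot (m : nat) : R[i] :=
  match m with 0 => 1 | 1 => -1 | S m' => sqrtc (dyroot m') end.

Lemma dyroot_half m : dyroot m.+1 ^+ (2 ^ m) = -1.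
Proof.
elim: m => [|m IH]; first by rewrite expr1.
by rewrite expnS exprM sqr_sqrtc.
Qed.

Lemma dyroot_prim m : (2 ^ m)%N.-primitive_root (dyroot m).
Proof.
case: m => [|m].
  apply/andP; split => //; apply/forallP => -[[|i] hi] //.
  by rewrite /= unity_rootE expr1 eqxx.
have h1 : dyroot m.+1 ^+ (2 ^ m.+1) = 1.
  by rewrite expnS mulnC exprM dyroot_half expr2 mulrNN mulr1.
have [d pd] := prim_order_exists (expn_gt0 2 m.+1) h1.
case/(dvdn_pfactor _ _ (isT : prime 2)) => k.
(* The order is [2 ^ k] with [k <= m.+1]. If [k <= m] it divides [2 ^ m], against [dyroot_half]. *)
rewrite leq_eqVlt => /orP[/eqP->|km] dk.
  by rewrite -dk.
have := prim_expr_order pd; have : (d %| 2 ^ m)%N by rewrite dk dvdn_exp2l.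
rewrite (prim_order_dvd pd) dyroot_half.
by rewrite eq_sym -subr_eq0 opprK -mulr2n pnatr_eq0.
Qed.

Lemma dyroot_neq0 m : dyroot m != 0.
Proof. by rewrite (prim_root_eq0 (dyroot_prim m)) -lt0n expn_gt0. Qed.

Lemma dyroot_unit m : dyroot m * conjc (dyroot m) = 1.
Proof.
rewrite -sqr_normc; have /eqP -> : `|dyroot m| == 1; last by rewrite expr1n.
rewrite -(@pexpr_eq1 _ _ (2 ^ m)) ?expn_gt0 // -normrX.
by rewrite (prim_expr_order (dyroot_prim m)) normr1.
Qed.

Lemma dyroot_exp_eq1 m (t : int) :
  (dyroot m ^ t == 1) = (2 ^ m %| `|t|)%N.
Proof.
case: t => n; first by rewrite -exprnP -(prim_order_dvd (dyroot_prim m)).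
by rewrite NegzE -exprnN invr_eq1 abszN -(prim_order_dvd (dyroot_prim m)).
Qed.

Lemma dyroot_conjX m (t : int) : conjc (dyroot m ^ t) = dyroot m ^ (- t).
Proof.
have h : conjc (dyroot m) = (dyroot m)^-1.
  by apply: (mulfI (dyroot_neq0 m)); rewrite dyroot_unit mulfV ?dyroot_neq0.
by rewrite fmorphXz /= h exprz_inv.
Qed.

Lemma dyroot_absX m (t : int) : cabs (dyroot m ^ t) = 1.
Proof.
have /(congr1 (@complex.Re R)) /= : ((cabs (dyroot m ^ t)) ^+ 2)%:C = 1.
  by rewrite -cabs_sqr dyroot_conjX -expfzDr ?dyroot_neq0 // subrr expr0z.
by move=> /eqP; rewrite sqrp_eq1 ?cabs_ge0 // => /eqP.
Qed.

Lemma dyroot_sum m (t : int) :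
  \sum_(j < 2 ^ m) dyroot m ^ (j%:Z * t) =
    if (2 ^ m %| `|t|)%N then (2 ^ m)%:R else 0.
Proof.
under eq_bigr do rewrite mulrC -exprz_exp.
rewrite -dyroot_exp_eq1; case: eqVneq => [->|h].
  under eq_bigr do rewrite exp1rz.
  by rewrite sumr_const card_ord.
have : (dyroot m ^ t - 1) * (\sum_(j < 2 ^ m) (dyroot m ^ t) ^+ j) = 0.
  by rewrite -subrX1 exprnP exprzAC -exprnP
    (prim_expr_order (dyroot_prim m)) exp1rz subrr.
by move/eqP; rewrite mulf_eq0 subr_eq0 (negPf h) => /eqP.
Qed.
End DyadicRoots.

(** * Sequences tending to zero in norm *)

Section TendsToZero.
Variables (R : realType) (V : normedModType R[i]).
Implicit Types (f g : nat -> V).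

Definition tends0 f := forall e : R, 0 < e ->
  exists m0, forall m, (m0 <= m)%N -> nrm (f m) < e.

Lemma tends0_0 : tends0 (fun=> 0).
Proof. by move=> e e0; exists 0 => m _; rewrite nrm0. Qed.

Lemma tends0_le f g :
  (forall m, nrm (f m) <= nrm (g m)) -> tends0 g -> tends0 f.
Proof.
move=> fg hg e /hg[m0 hm]; exists m0 => m /hm; exact: le_lt_trans.
Qed.

Lemma tends0D f g : tends0 f -> tends0 g -> tends0 (fun m => f m + g m).
Proof.
move=> hf hg e e0; have e20 : 0 < e / 2 by rewrite divr_gt0.
have [m1 h1] := hf _ e20; have [m2 h2] := hg _ e20.
exists (maxn m1 m2) => m; rewrite geq_max => /andP[/h1 + /h2].
by have := nrmD (f m) (g m); lra.
Qed.

Lemma tends0_sum (I : Type) (r : seq I) (F : I -> nat -> V) :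
  (forall i, tends0 (F i)) -> tends0 (fun m => \sum_(i <- r) F i m).
Proof.
move=> hF; elim: r => [|i r IH].
  by apply: tends0_le tends0_0 => m; rewrite big_nil.
by apply: tends0_le (tends0D (hF i) IH) => m; rewrite big_cons.
Qed.

Lemma tends0Z a f : tends0 f -> tends0 (fun m => a *: f m).
Proof.
move=> hf e e0; have a0 := cabs_ge0 a.
have [|m0 h] := hf (e / (cabs a + 1)); first by rewrite divr_gt0 // ltr_wpDl.
exists m0 => m /h; rewrite nrmZ ltr_pdivlMr ?ltr_wpDl //.
by have := nrm_ge0 (f m); lra.
Qed.
End TendsToZero.

(** * Fejer summation *)

Section FejerCount.

(** The number of pairs [i, i'] below [N] with [i - i' = k]: this is [N] times the triangular weight
    of the Fejer means. *)
Definition shift_count (N : nat) (k : int) : nat :=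
  (\sum_(i < N) (0 <= i%:Z - k < N%:Z)%R)%N.

Lemma shift_count_le N k : (shift_count N k <= N)%N.
Proof.
rewrite -[leqRHS]muln1 -[X in (_ <= X * _)%N](card_ord N) -sum_nat_const.
by apply: leq_sum => i _; case: (_ <= _ < _).
Qed.

Lemma sum_ltn_le N n : (\sum_(i < N) (i < n) <= n)%N.
Proof.
suff -> : (\sum_(i < N) (i < n) = minn N n)%N by exact: geq_minr.
elim: N => [|N IH]; first by rewrite big_ord0 min0n.
by rewrite big_ord_recr /= IH; case: ltnP; lia.
Qed.

Lemma shift_count_ge N k : (N <= shift_count N k + `|k|)%N.
Proof.
suff h : (N - shift_count N k <= `|k|)%N by move: h; lia.
have -> : (N - shift_count N k = \sum_(i < N) ~~ (0 <= i%:Z - k < N%:Z)%R)%N.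
  suff {1}<- :
      (shift_count N k + \sum_(i < N) ~~ (0 <= i%:Z - k < N%:Z)%R = N)%N.
    by rewrite addKn.
  rewrite -big_split /= -[RHS](card_ord N) -sum1_card.
  by apply: eq_bigr => i _; case: (_ <= _ < _)%R.
case: k => k.
  apply: leq_trans (sum_ltn_le N k); apply: leq_sum => i _.
  have := ltn_ord i; case: (ltnP i k) => h; rewrite ?leq_b1 //.
  by rewrite leqn0 eqb0 negbK; lia.
(* The shift is now [- k.+1], so the indices that leave the range are the last [k.+1]; reversal
   makes them the first ones. *)
rewrite (reindex_inj rev_ord_inj); apply: leq_trans (sum_ltn_le N k.+1).
apply: leq_sum => i _ /=.
have := ltn_ord i; case: (ltnP i k.+1) => h; rewrite ?leq_b1 //.
by rewrite leqn0 eqb0 negbK; lia.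
Qed.

End FejerCount.

Section Fejer.
Variables (R : realType) (V : normedModType R[i]) (G : nat -> nat -> V -> V).
Hypothesis GD : forall m j, {morph G m j : x y / x + y}.
Hypothesis Gcontr : forall m j x, nrm (G m j x) <= nrm x.
Implicit Types (x y : V) (k : int).

Local Notation z := (@dyroot R).

(** Fourier coefficient at resolution [m]: the integral over the circle becomes a mean over the
    [2 ^ m]-th roots of unity, [G m j] standing for the action of [z m ^ j]. *)
Definition fourier k m x : V :=
  ((2 ^ m)%:R)^-1 *: \sum_(j < 2 ^ m) z m ^ (- (j%:Z * k)) *: G m j x.

(** Only large [m] count, because a monomial is seen to be an eigenvector of the clock action at
    scales at least as fine as its own. *)
Definition homog k x := exists m0, forall m, (m0 <= m)%N ->
  forall j, G m j x = z m ^ (j%:Z * k) *: x.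

(** Grouping the pairs by [k = i - i'] gives the Cesaro mean with weights [1 - |k| / N]. *)
Definition fejer N m x : V :=
  (N%:R)^-1 *: \sum_(i < N) \sum_(i' < N) fourier (i%:Z - i'%:Z) m x.

Lemma fourierD k m : {morph fourier k m : x y / x + y}.
Proof.
move=> x y; rewrite /fourier -scalerDr -big_split /=; congr (_ *: _).
by apply: eq_bigr => j _; rewrite GD scalerDr.
Qed.

Lemma fejerD N m : {morph fejer N m : x y / x + y}.
Proof.
move=> x y; rewrite /fejer -scalerDr -big_split /=; congr (_ *: _).
apply: eq_bigr => i _; rewrite -big_split /=.
by apply: eq_bigr => i' _; rewrite fourierD.
Qed.

Lemma fourier_contr k m x : nrm (fourier k m x) <= nrm x.
Proof.
have M0 : (0 : R) < (2 ^ m)%:R by rewrite ltr0n expn_gt0.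
rewrite /fourier nrmZ.
have -> : ((2 ^ m)%:R^-1 : R[i]) = ((2 ^ m)%:R^-1 : R)%:C.
  by rewrite fmorphV rmorph_nat.
rewrite cabs_real ger0_norm ?invr_ge0 ?(ltW M0) // mulrC ler_pdivrMr //.
apply: le_trans (nrm_sum _ _ _) _.
apply: (@le_trans _ _ (\sum_(j < 2 ^ m) nrm x)).
  by apply: ler_sum => j _; rewrite nrmZ dyroot_absX mul1r.
by rewrite sumr_const card_ord mulr_natr.
Qed.

Lemma fourier_eigen k k' m x : (forall j, G m j x = z m ^ (j%:Z * k') *: x) ->
  fourier k m x = (2 ^ m %| absz (k' - k)%R)%N%:R *: x.
Proof.
move=> Gx; rewrite /fourier; under eq_bigr do rewrite Gx scalerA.
have M0 : (2 ^ m)%:R != 0 :> R[i] by rewrite pnatr_eq0 -lt0n expn_gt0.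
rewrite -scaler_suml scalerA; congr (_ *: _).
under eq_bigr => j _.
  rewrite -expfzDr ?dyroot_neq0 // (_ : _ + _ = j%:Z * (k' - k)); last by ring.
  over.
by rewrite dyroot_sum; case: ifP => _; rewrite ?mulVf ?mulr0.
Qed.

Definition fejer_kernel N m (j : nat) : R :=
  (N%:R * (2 ^ m)%:R)^-1 * cabs (\sum_(i < N) z m ^ (- (j%:Z * i%:Z))) ^+ 2.

Lemma fejer_kernel_ge0 N m j : 0 <= fejer_kernel N m j.
Proof. by rewrite mulr_ge0 ?exprn_ge0 ?cabs_ge0 // invr_ge0 mulr_ge0. Qed.

Lemma fejer_kernelE N m j : (fejer_kernel N m j)%:C = (N%:R * (2 ^ m)%:R)^-1 *
  \sum_(i < N) \sum_(i' < N) z m ^ (- (j%:Z * (i%:Z - i'%:Z))).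
Proof.
rewrite rmorphM fmorphV rmorphM !rmorph_nat /= -cabs_sqr rmorph_sum /=.
rewrite big_distrlr /=; congr (_ * _).
apply: eq_bigr => i _; apply: eq_bigr => i' _.
rewrite dyroot_conjX -expfzDr ?dyroot_neq0 //; congr (_ ^ _); lia.
Qed.

Lemma fejer_kernel_sum N m x :
  fejer N m x = \sum_(j < 2 ^ m) (fejer_kernel N m j)%:C *: G m j x.
Proof.
rewrite /fejer /fourier.
under eq_bigr => i _ do rewrite -scaler_sumr exchange_big /=.
rewrite -scaler_sumr exchange_big /= scalerA -invfM scaler_sumr.
apply: eq_bigr => j _; rewrite fejer_kernelE -scalerA; congr (_ *: _).
rewrite scaler_suml; apply: eq_bigr => i _.
by rewrite scaler_suml.
Qed.

(** The hypothesis excludes aliasing: [i' - i + k] is smaller than [2 ^ m] in absolute value, so it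
    is divisible by [2 ^ m] only if it vanishes. *)
Lemma fejer_kernel_fourier N m k : (N + `|k| <= 2 ^ m)%N ->
  \sum_(j < 2 ^ m) (fejer_kernel N m j)%:C * z m ^ (j%:Z * k) =
    (shift_count N k)%:R / N%:R.
Proof.
move=> Nm; under eq_bigr do rewrite fejer_kernelE -mulrA mulr_suml.
rewrite -mulr_sumr exchange_big /=.
rewrite (_ : \sum_(i < N) _ = (shift_count N k)%:R * (2 ^ m)%:R).
  have M0 : (2 ^ m)%:R != 0 :> R[i] by rewrite pnatr_eq0 -lt0n expn_gt0.
  by rewrite invfM -mulrA [X in _ * X]mulrC mulfK // mulrC.
rewrite natr_sum mulr_suml; apply: eq_bigr => i _.
under eq_bigr do rewrite mulr_suml.
rewrite exchange_big /=.
have E (i' : 'I_N) : \sum_(j < 2 ^ m) z m ^ (- (j%:Z * (i%:Z - i'%:Z))) *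
    z m ^ (j%:Z * k) = (i'%:Z == i%:Z - k)%R%:R * (2 ^ m)%:R.
  under eq_bigr => j _.
    rewrite -expfzDr ?dyroot_neq0 //.
    rewrite (_ : _ + _ = j%:Z * (i'%:Z - i%:Z + k)); last by ring.
    over.
  rewrite dyroot_sum; case: eqP => [->|h].
    by rewrite (_ : i%:Z - k - i%:Z + k = 0) ?dvdn0 ?mul1r //; ring.
  case: ifP => [/dvdn_leq|_]; last by rewrite mul0r.
  have := ltn_ord i; have := ltn_ord i'; move: Nm h; lia.
under eq_bigr do rewrite E.
rewrite -mulr_suml -natr_sum; congr (_%:R * _).
case: (boolP (0 <= i%:Z - k < N%:Z)) => h.
  have h' : (`|i%:Z - k| < N)%N by lia.
  rewrite (bigD1 (Ordinal h')) //= big1 ?addn0.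
    by rewrite gez0_abs ?eqxx; lia.
  move=> i' /eqP ne; apply/eqP; rewrite eqb0; apply/eqP => e; apply: ne.
  by apply: val_inj; rewrite /= -e.
rewrite big1 // => i' _; apply/eqP; rewrite eqb0; apply/eqP => e.
have := ltn_ord i'; move: h; lia.
Qed.

Lemma fejer_kernel_mass N m : (0 < N <= 2 ^ m)%N ->
  \sum_(j < 2 ^ m) fejer_kernel N m j = 1.
Proof.
move=> /andP[N0 Nm].
have c0 : shift_count N 0 = N.
  apply/eqP; rewrite eqn_leq shift_count_le /=.
  by have := shift_count_ge N 0; lia.
apply: complexI; rewrite rmorph_sum rmorph1 /=.
have := @fejer_kernel_fourier N m 0; rewrite c0 addn0 divff ?pnatr_eq0 -?lt0n //.
by move=> <- //; apply: eq_bigr => j _; rewrite mulr0 expr0z mulr1.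
Qed.

(** The kernel is nonnegative of mass 1, so a Fejer mean is a convex combination of the contractions
    [G m j]. *)
Lemma fejer_contr N m x : (0 < N <= 2 ^ m)%N -> nrm (fejer N m x) <= nrm x.
Proof.
move=> Nm; rewrite fejer_kernel_sum; apply: le_trans (nrm_sum _ _ _) _.
rewrite -[leRHS]mul1r -(fejer_kernel_mass Nm) mulr_suml.
apply: ler_sum => j _; rewrite nrmZ cabs_real ger0_norm ?fejer_kernel_ge0 //.
by rewrite ler_wpM2l ?fejer_kernel_ge0.
Qed.

Lemma fejer_homog k x : homog k x -> exists m0, forall N m,
  (0 < N)%N -> (m0 <= m)%N -> (N + `|k| <= 2 ^ m)%N ->
  nrm (fejer N m x - x) <= `|k|%:R / N%:R * nrm x.
Proof.
move=> [m0 hm]; exists m0 => N m N0 m0m Nm.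
rewrite fejer_kernel_sum; under eq_bigr do rewrite hm // scalerA.
rewrite -scaler_suml fejer_kernel_fourier //.
rewrite -[X in nrm (_ - X)]scale1r -scalerBl nrmZ.
rewrite ler_wpM2r ?nrm_ge0 //.
have Nr : N%:R != 0 :> R by rewrite pnatr_eq0 -lt0n.
have -> : (shift_count N k)%:R / N%:R - 1 =
    (((shift_count N k)%:R - N%:R) / N%:R : R)%:C.
  rewrite rmorphM fmorphV rmorphB !rmorph_nat mulrBl divff //.
  by rewrite pnatr_eq0 -lt0n.
rewrite cabs_real normrM [X in _ * X]ger0_norm ?invr_ge0 // ler_pM2r; last first.
  by rewrite invr_gt0 ltr0n.
rewrite distrC ger0_norm ?subr_ge0 ?ler_nat ?shift_count_le //.
by rewrite lerBlDl -natrD ler_nat shift_count_ge.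
Qed.

(** [N] is chosen first, from the degrees and norms of the finitely many summands; the resolution
    [m] then depends on [N]. *)
Lemma fejer_approx (l : seq V) : (forall v, v \in l -> exists k, homog k v) ->
  forall e : R, 0 < e -> exists2 N0, (0 < N0)%N & forall N, (N0 <= N)%N ->
  exists m0, forall m, (m0 <= m)%N ->
    nrm (fejer N m (\sum_(v <- l) v) - \sum_(v <- l) v) <= e.
Proof.
elim: l => [|v l IH] hl e e0.
  exists 1%N => // N _; exists 0%N => m _; rewrite big_nil subr0.
  have -> : fejer N m 0 = 0.
    by apply: (addrI (fejer N m 0)); rewrite -fejerD !addr0.
  by rewrite nrm0 ltW.
have e20 : 0 < e / 2 by rewrite divr_gt0.
have [|N1 N10 h1] := IH _ _ e20.
  by move=> w wl; apply: hl; rewrite inE wl orbT.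
have [k /fejer_homog[m2 h2]] := hl v (mem_head _ _).
pose C := `|k|%:R * nrm v / (e / 2).
exists (maxn N1 (Num.truncn C).+1); first by rewrite leq_max N10.
move=> N; rewrite geq_max => /andP[N1N CN]; have N0 := leq_trans N10 N1N.
have [m1 {}h1] := h1 N N1N.
exists (maxn m1 (maxn m2 (N + `|k|))) => m.
rewrite !geq_max => /and3P[m1m m2m m3m].
rewrite big_cons fejerD opprD addrACA.
have := nrmD (fejer N m v - v) (fejer N m (\sum_(w <- l) w) - \sum_(w <- l) w).
have m2X : (m <= 2 ^ m)%N by rewrite ltnW // ltn_expl.
have := h1 m m1m; have := h2 N m N0 m2m (leq_trans m3m m2X).
have : `|k|%:R / N%:R * nrm v <= e / 2.
  rewrite mulrAC ler_pdivrMr ?ltr0n // [leRHS]mulrC -ler_pdivrMr // -/C.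
  apply: ltW; apply: lt_le_trans (truncnS_gt _) _.
  by rewrite ler_nat.
lra.
Qed.

(** For fixed [N] the Fejer mean of [x] is a finite combination of coefficients, so it tends to 0
    with [m]. It is also close to [x], as it almost fixes the approximating sum and contracts the
    error. *)
Lemma fejer_uniqueness x :
  (forall e : R, 0 < e -> exists2 l : seq V,
     (forall v, v \in l -> exists k, homog k v) &
     nrm (x - \sum_(v <- l) v) < e) ->
  (forall k, tends0 (fun m => fourier k m x)) ->
  x = 0.
Proof.
move=> xl xF; apply: nrm_small0 => e e0.
have e40 : 0 < e / 4 by rewrite divr_gt0.
have [l hl xle] := xl _ e40.
have [N N0 /(_ N (leqnn _))[m1 h1]] := fejer_approx hl e40.
have : tends0 (fun m => fejer N m x).
  apply: tends0Z; apply: tends0_sum => i; apply: tends0_sum => i'.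
  exact: xF.
move=> /(_ _ e40)[m2 h2].
pose m := maxn N (maxn m1 m2).
have := h1 m; rewrite !leq_max leqnn orbT => /(_ isT).
have := h2 m; rewrite !leq_max leqnn !orbT => /(_ isT).
set X := \sum_(v <- l) v in xle *.
have : nrm (fejer N m (X - x)) <= nrm (X - x).
  apply: fejer_contr; rewrite N0 /= (leq_trans (n := 2 ^ N)) //.
    by rewrite ltnW // ltn_expl.
  by rewrite leq_exp2l // leq_maxl.
have -> : fejer N m (X - x) = fejer N m X - fejer N m x.
  by apply/eqP; rewrite eq_sym subr_eq -fejerD subrK.
rewrite [nrm (X - x)]nrmBC.
set a := fejer N m X; set b := fejer N m x.
have := nrmD (x - X) (X - a); have := nrmD (x - X + (X - a)) (a - b).
have := nrmD (x - X + (X - a) + (a - b)) b.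
rewrite subrKA subrKA subrK [nrm (X - a)]nrmBC; lra.
Qed.

End Fejer.

(** * Fourier coefficients of products with a homogeneous factor *)

Section FourierAlgebra.
Variables (R : realType) (A : cstarAlgType R) (G : nat -> nat -> A -> A).
Hypothesis GM : forall m j, {morph G m j : x y / x * y}.
Implicit Types (x y : A) (k : int).

(** Pulling a homogeneous factor out of the mean shifts the degree; this later reduces every
    coefficient to degree 0. *)
Lemma fourier_mulr k k' m x y :
  (forall j, G m j y = dyroot R m ^ (j%:Z * k') *: y) ->
  fourier G k m (x * y) = fourier G (k - k') m x * y.
Proof.
move=> Gy; rewrite /fourier -scalerAl mulr_suml; congr (_ *: _).
apply: eq_bigr => j _; rewrite GM Gy -scalerAr scalerA -scalerAl.
by rewrite -expfzDr ?dyroot_neq0 //; congr (_ ^ _ *: _); ring.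
Qed.

Lemma fourier_mull k k' m x y :
  (forall j, G m j y = dyroot R m ^ (j%:Z * k') *: y) ->
  fourier G k m (y * x) = y * fourier G (k - k') m x.
Proof.
move=> Gy; rewrite /fourier -scalerAr mulr_sumr; congr (_ *: _).
apply: eq_bigr => j _; rewrite GM Gy -scalerAl scalerA -scalerAr.
by rewrite -expfzDr ?dyroot_neq0 //; congr (_ ^ _ *: _); ring.
Qed.

End FourierAlgebra.

(** * Monomials and their compressions *)

Section Relations.
Variables (R : realType) (A : cstarAlgType R) (u s : A).
Hypothesis rel : Q2_relations u s.
Implicit Types (k l : int) (p q m n : nat).

Let uVu : u^* * u = 1. Proof. by case: rel => -[]. Qed.
Let uuV : u * u^* = 1. Proof. by case: rel => -[]. Qed.
Let sVs : s^* * s = 1. Proof. by case: rel. Qed.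
Let su : s * u = u ^+ 2 * s. Proof. by case: rel. Qed.
Let range_sum : s * s^* + u * s * s^* * u^* = 1. Proof. by case: rel. Qed.

Definition upow k : A :=
  match k with Posz n => u ^+ n | Negz n => u^* ^+ n.+1 end.

Lemma upow0 : upow 0 = 1. Proof. by rewrite /= expr0. Qed.
Lemma upow1 : upow 1 = u. Proof. by rewrite /= expr1. Qed.

Lemma upowS k : upow (k + 1) = u * upow k.
Proof.
case: k => [n|[|n]]; first by rewrite -PoszD addn1 /= exprS.
  by rewrite (_ : Negz 0 + 1 = 0) //= expr1 expr0 uuV.
rewrite (_ : Negz n.+1 + 1 = Negz n) /=; last by rewrite !NegzE; lia.
by rewrite [u^* ^+ n.+2]exprS mulrA uuV mul1r.
Qed.

Lemma upowP k : upow (k - 1) = u^* * upow k.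
Proof. by rewrite -[in RHS](subrK 1 k) upowS mulrA uVu mul1r. Qed.

Lemma upowD k l : upow (k + l) = upow k * upow l.
Proof.
elim/int_rec: k => [|n IH|n IH]; first by rewrite add0r upow0 mul1r.
  by rewrite -addn1 PoszD addrAC !upowS IH mulrA.
by rewrite -addn1 PoszD opprD addrAC !upowP IH mulrA.
Qed.

Lemma upowN_l k : upow (- k) * upow k = 1.
Proof. by rewrite -upowD addNr upow0. Qed.

Lemma star_upow k : (upow k)^* = upow (- k).
Proof.
have sX (x : A) n : (x ^+ n)^* = x^* ^+ n.
  by elim: n => [|n IH]; rewrite ?expr0 ?star1 // exprS exprSr starM IH.
case: k => [[|n]|n]; rewrite ?NegzE.
- by rewrite oppr0 upow0 star1.
- by rewrite -NegzE /= sX.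
- by rewrite opprK /= sX starK.
Qed.

Lemma s_upow k : s * upow k = upow (k *+ 2) * s.
Proof.
have pos n : s * upow n = upow (n%:Z *+ 2) * s.
  elim: n => [|n IH]; first by rewrite mul0rn upow0 mulr1 mul1r.
  rewrite -addn1 PoszD upowS mulrA su -mulrA IH mulrA; congr (_ * _).
  by rewrite expr2 -mulrA -!upowS; congr upow; lia.
case: k => n; first exact: pos.
rewrite NegzE mulNrn -[LHS]mul1r -(upowN_l (n.+1%:Z *+ 2)) -mulrA.
by congr (_ * _); rewrite mulrA -pos -mulrA -upowD subrr upow0 mulr1.
Qed.

Lemma sX_upow n k : s ^+ n * upow k = upow (k * (2 ^ n)%:Z) * s ^+ n.
Proof.
elim: n k => [|n IH] k; first by rewrite expn0 mulr1 expr0 mulr1 mul1r.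
rewrite exprS -mulrA IH mulrA s_upow -mulrA; congr (upow _ * _).
by rewrite expnS; lia.
Qed.

(** Multiplying the range relation by [s^*] on the left makes its first summand cancel the right
    side; multiplying what remains by [u * s] on the right isolates the product. *)
Lemma sVus : s^* * u * s = 0.
Proof.
have : s^* = s^* + s^* * u * s * (s^* * u^*).
  by rewrite -{1}(mulr1 s^*) -{1}range_sum mulrDr !mulrA sVs mul1r.
rewrite -[X in X = _]addr0 => /addrI/(congr1 (fun x => x * (u * s))).
by rewrite mul0r -!mulrA [u^* * _]mulrA uVu mul1r sVs mulr1 !mulrA => <-.
Qed.

Lemma sXVsX n : (s ^+ n)^* * s ^+ n = 1.
Proof.
elim: n => [|n IH]; first by rewrite expr0 star1 mulr1.
by rewrite exprS starM -mulrA [s^* * _]mulrA sVs mul1r.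
Qed.

Lemma upow_sX k n : (2 ^ n %| `|k|)%N ->
  upow k * s ^+ n = s ^+ n * upow (k %/ (2 ^ n)%:Z)%Z.
Proof.
by move=> h; rewrite sX_upow divzK // /dvdz /= ?inE.
Qed.

Lemma compress_upow n k : (s ^+ n)^* * upow k * s ^+ n =
  if (2 ^ n %| `|k|)%N then upow (k %/ (2 ^ n)%:Z)%Z else 0.
Proof.
case: ifP => [h|]; first by rewrite -mulrA upow_sX // mulrA sXVsX mul1r.
elim: n k => [|n IH] k; first by rewrite expn0 dvd1n.
move=> ndv.
(* Split [k] by parity: an even power of [u] passes through [s^*] with half the exponent, an odd one
   leaves the factor [s^* * u * s = 0]. *)
have [l [r [rb ke]]] : exists l (r : nat), (r < 2)%N /\ k = l *+ 2 + r%:Z.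
  exists (k %/ 2)%Z, `|(k %% 2)%Z|%N; split.
    have := ltz_pmod k (isT : (0 : int) < 2).
    by have := modz_ge0 k (isT : (2 : int) != 0); lia.
  by rewrite [LHS](divz_eq k 2) gez0_abs ?modz_ge0 //; lia.
rewrite {k}ke in ndv *; rewrite exprS starM.
have -> : upow (l *+ 2 + r%:Z) = upow (l *+ 2) * u ^+ r by rewrite upowD.
have E : s^* * upow (l *+ 2) = upow l * s^*.
  rewrite -[LHS]starK starM starK star_upow -mulNrn -s_upow.
  by rewrite starM star_upow opprK.
case: r rb ndv => [|[|r]] // _ ndv.
  rewrite expr0 mulr1 -!mulrA [s^* * _]mulrA E -[upow l * _ * _]mulrA.
  rewrite [s^* * (s * _)]mulrA sVs mul1r mulrA IH //.
  have E2 : `|l *+ 2|%N = (2 * `|l|)%N by lia.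
  by move: ndv; rewrite addr0 E2 expnS dvdn_pmul2l.
rewrite expr1 -!mulrA [s^* * _]mulrA E -[upow l * _ * _]mulrA.
by rewrite [u * _]mulrA [s^* * _]mulrA [s^* * _]mulrA sVus !mul0r !mulr0.
Qed.

Lemma upow_sXV n k : upow k * (s ^+ n)^* = (s ^+ n)^* * upow (k * (2 ^ n)%:Z).
Proof.
rewrite -[LHS]starK starM starK star_upow sX_upow.
by rewrite starM star_upow mulNr opprK.
Qed.

Definition mono (a : int) p q (b : int) : A :=
  upow a * s ^+ p * (s ^+ q)^* * upow b.

Lemma star_mono a p q b : (mono a p q b)^* = mono (- b) q p (- a).
Proof. by rewrite /mono !starM starK !star_upow !mulrA. Qed.

Lemma upow_mono k a p q b : upow k * mono a p q b = mono (k + a) p q b.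
Proof. by rewrite /mono upowD !mulrA. Qed.

Lemma s_mono a p q b : s * mono a p q b = mono (a *+ 2) p.+1 q b.
Proof. by rewrite /mono !mulrA s_upow -[_ * s * _]mulrA -exprS. Qed.

Lemma sV_mono a p q b : s^* * mono a p q b = 0 \/
  exists a' p' q' b', s^* * mono a p q b = mono a' p' q' b'.
Proof.
case: p => [|p].
  (* Moving [upow a] to the right of the adjoint of [s ^+ q] multiplies its exponent by [2 ^ q],
     after which [s^*] is absorbed. *)
  right; exists 0, 0, q.+1, (a * (2 ^ q)%:Z + b).
  rewrite /mono expr0 !mulr1 upow0 mul1r exprSr starM upowD !mulrA.
  by congr (_ * _); rewrite -!mulrA upow_sXV.
rewrite /mono exprS !mulrA; have := compress_upow 1 a; rewrite expr1 => ->.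
case: ifP => _; last by left; rewrite !mul0r.
by right; exists (a %/ (2 ^ 1)%:Z)%Z, p, q, b.
Qed.


(** In the representation on l^2(Z) where [u] shifts the basis by 1 and [s] doubles its indices, the
    range of this isometry is spanned by the residue class of [b] modulo [2 ^ n]. *)
Definition cell n b : A := upow b * s ^+ n.

Lemma cell_isometric n b : isometric (cell n b).
Proof.
by rewrite /isometric /cell starM star_upow -mulrA [upow _ * _]mulrA upowN_l
  mul1r sXVsX.
Qed.

Lemma cell_orth n a b : (cell n a)^* * cell n b =
  if (2 ^ n %| absz (b - a)%R)%N then upow ((b - a) %/ (2 ^ n)%:Z)%Z else 0.
Proof.
rewrite -compress_upow /cell starM star_upow -!mulrA; congr (_ * _).
by rewrite !mulrA -upowD addrC.
Qed.

(* Both sides of a monomial are absorbed by [s ^+ M], and what remains is a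
   compression of a power of [u]. *)
Lemma compress_mono M b a p q c : (p <= M)%N -> (q <= M)%N ->
  (cell M b)^* * mono a p q c * cell M b =
  if (2 ^ p %| absz (a - b)%R)%N && (2 ^ q %| absz (c + b)%R)%N then
    (s ^+ (M - p))^* *
    upow (((a - b) %/ (2 ^ p)%:Z)%Z + ((c + b) %/ (2 ^ q)%:Z)%Z) * s ^+ (M - q)
  else 0.
Proof.
move=> pM qM.
have hq : (s ^+ q)^* * upow (c + b) * s ^+ M =
    if (2 ^ q %| absz (c + b)%R)%N then
      upow ((c + b) %/ (2 ^ q)%:Z)%Z * s ^+ (M - q) else 0.
  rewrite -{1}(subnKC qM) exprD mulrA compress_upow.
  by case: ifP => // _; rewrite mul0r.
have hp : (s ^+ M)^* * upow (a - b) * s ^+ p =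
    if (2 ^ p %| absz (a - b)%R)%N then
      (s ^+ (M - p))^* * upow ((a - b) %/ (2 ^ p)%:Z)%Z else 0.
  rewrite -{1}(subnKC pM) exprD starM -!mulrA [X in _ * X]mulrA compress_upow.
  by case: ifP => // _; rewrite mulr0.
have -> : (cell M b)^* * mono a p q c * cell M b =
    ((s ^+ M)^* * upow (a - b) * s ^+ p) * ((s ^+ q)^* * upow (c + b) * s ^+ M).
  by rewrite /cell /mono starM star_upow (addrC a) !upowD !mulrA.
rewrite hp hq; case: ifP => _ /=; last by rewrite mul0r.
case: ifP => _ /=; last by rewrite mulr0.
by rewrite upowD !mulrA.
Qed.

(** For [p = q] and [a + c = 0] the monomial is the projection onto the residue class of [a] modulo
    [2 ^ p], and this is its diagonal entry at [b]. The isolated fixed point possible for [p != q]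
    is ignored. *)
Definition diag_coef (a : int) p q (c : int) (b : int) : R[i] :=
  ((p == q) && (a + c == 0) && (2 ^ p %| absz (c + b)%R)%N)%:R.

Lemma compress_diag a p c : exists M0, forall M b, (M0 <= M)%N ->
  (cell M b)^* * mono a p p c * cell M b = diag_coef a p p c b *: 1.
Proof.
(* The exponent [t] below satisfies [t * 2 ^ p = a + c], so this bound makes [2 ^ (M - p)] exceed
   [|t|]. It is uniform in [b]. *)
exists (p + absz (a + c)%R)%N => M b hM.
have pM : (p <= M)%N by lia.
rewrite compress_mono // /diag_coef eqxx /=.
have P0 := expn_gt0 2 p.
case: (boolP (2 ^ p %| absz (a - b)%R)%N) => h1 /=; last first.
  case: eqVneq => [ac|_] /=; last by rewrite scale0r.
  by rewrite (_ : c + b = - (a - b)) ?abszN ?(negPf h1) ?scale0r //; lia.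
case: (boolP (2 ^ p %| absz (c + b)%R)%N) => h2 /=;
  last by rewrite andbF scale0r.
set t := ((a - b) %/ _)%Z + _.
have tE : t * (2 ^ p)%:Z = a + c.
  by rewrite /t mulrDl !divzK /dvdz /= ?inE //; lia.
rewrite andbT; case: eqVneq tE => [->|ac] tE /=.
  have /eqP : t * (2 ^ p)%:Z = 0 by [].
  rewrite mulf_eq0 eqz_nat => /orP[/eqP->|]; last by lia.
  by rewrite upow0 mulr1 sXVsX scale1r.
rewrite scale0r compress_upow; case: ifP => // /dvdn_leq h.
have := ltn_expl (M - p) (isT : (1 < 2)%N).
move: tE ac hM h P0; move: (2 ^ p)%N (2 ^ (M - p))%N => P Q tE ac hM h P0 hQ.
have : (absz t * P = absz (a + c)%R)%N by rewrite -tE abszM.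
nia.
Qed.

(* The monomial acts on the 2-adic integers by x |-> 2^(p-q) (x + c) + a, which
   has at most one fixed point; any larger [b] is moved, hence so is its cell of
   small enough radius. *)
Lemma compress_offdiag a p q c : p != q -> exists B : nat, forall b : nat,
  (B <= b)%N -> exists M0, forall M, (M0 <= M)%N ->
  (cell M b)^* * mono a p q c * cell M b = 0.
Proof.
(* If the exponent [t] below were 0, then [(2 ^ q - 2 ^ p) * b = a * 2 ^ q + c * 2 ^ p]; the bound
   puts [b] beyond the absolute value of the right side. *)
move=> pq; exists (2 ^ q * absz a + 2 ^ p * absz c).+1 => b hb.
exists (p + q + absz a + absz c + 2 * b)%N => M hM.
rewrite compress_mono; [|lia|lia].
case: ifP => // /andP[h1 h2].
set t := ((a - b%:Z) %/ (2 ^ p)%:Z)%Z + ((c + b%:Z) %/ (2 ^ q)%:Z)%Z.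
have P0 := expn_gt0 2 p; have Q0 := expn_gt0 2 q.
have tE : t * ((2 ^ p)%:Z * (2 ^ q)%:Z) =
    (a - b%:Z) * (2 ^ q)%:Z + (c + b%:Z) * (2 ^ p)%:Z.
  rewrite /t mulrDl mulrA divzK; last by rewrite /dvdz /= ?inE.
  by rewrite [(2 ^ p)%:Z * _]mulrC mulrA divzK // /dvdz /= ?inE.
have PQ : (2 ^ p)%N <> (2 ^ q)%N.
  by move=> /eqP; rewrite eqn_exp2l // (negPf pq).
have t0 : t != 0.
  apply/eqP => t0; move: tE hb PQ P0 Q0; rewrite t0 mul0r.
  move: (2 ^ p)%N (2 ^ q)%N => P Q.
  clear -P Q => tE hb PQ P0 Q0.
  have [PQ'|PQ'] : (P < Q)%N \/ (Q < P)%N by lia.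
    have : (Q%:Z - P%:Z) * b%:Z = a * Q%:Z + c * P%:Z by lia.
    nia.
  have : (P%:Z - Q%:Z) * b%:Z = - (a * Q%:Z + c * P%:Z) by lia.
  nia.
have tle : (absz t <= absz (a - b%:Z)%R + absz (c + b%:Z)%R)%N.
  clearbody t; clear t0; move: tE P0 Q0; move: (2 ^ p)%N (2 ^ q)%N => P Q; clear.
  move: (a - b%:Z) (c + b%:Z) => x y tE P0 Q0.
  have h : (absz t * (P * Q) <= absz x * Q + absz y * P)%N.
    have e1 : absz (t * (P%:Z * Q%:Z)) = (absz t * (P * Q))%N by rewrite !abszM.
    have e2 : absz (x * Q%:Z) = (absz x * Q)%N by rewrite abszM.
    have e3 : absz (y * P%:Z) = (absz y * P)%N by rewrite abszM.
    rewrite -e1 -e2 -e3 tE; move: (x * _) (y * _); clear; lia.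
  rewrite -(@leq_pmul2r (P * Q)) ?muln_gt0 ?P0 //; apply: leq_trans h _.
  by rewrite mulnDl leq_add // leq_mul // ?leq_pmull ?leq_pmulr.
have t_gt0 : (0 < absz t)%N by rewrite lt0n absz_eq0.
clearbody t; clear tE t0 h1 h2 PQ hb P0 Q0.
have tn n : (absz t <= n)%N -> (2 ^ n %| absz t)%N = false.
  by move=> tn; rewrite gtnNdvd //; apply: leq_ltn_trans tn (ltn_expl _ _).
(* Compressing by the smaller of the two powers of [s] already kills [upow t], since [t] is nonzero
   and too small to be divisible by the corresponding power of 2. *)
have [pq'|pq'] : (p < q)%N \/ (q < p)%N by move: pq; case: ltngtP; auto.
  have -> : (M - p = (M - q) + (q - p))%N by lia.
  rewrite exprD starM -2!mulrA [X in _ * X]mulrA compress_upow tn ?mulr0 //.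
  by lia.
have -> : (M - q = (M - p) + (p - q))%N by lia.
by rewrite exprD mulrA compress_upow tn ?mul0r //; lia.
Qed.

End Relations.

(** * Diagonal elements and the clock automorphisms *)

Section Diagonal.
Variables (R : realType) (A : cstarAlgType R) (u s : A).
Hypothesis rel : Q2_relations u s.
Implicit Types (m n : nat) (f g : nat -> R[i]).

Local Notation cell := (cell u s).
Local Notation upow := (upow u).

Definition cell_proj n (b : int) : A := cell n b * (cell n b)^*.

Lemma star_cell_proj n b : (cell_proj n b)^* = cell_proj n b.
Proof. by rewrite /cell_proj starM starK. Qed.

Lemma cell_orth_ord n (a b : 'I_(2 ^ n)) :
  (cell n a)^* * cell n b = if a == b then 1 else 0.
Proof.
rewrite (cell_orth rel); case: eqVneq => [->|ab].
  by rewrite subrr dvdn0 div0z (upow0 u).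
case: ifP => // /dvdn_leq; have := ltn_ord a; have := ltn_ord b.
by move: ab; rewrite -val_eqE /=; lia.
Qed.

Lemma cell_projM n (a b : 'I_(2 ^ n)) :
  cell_proj n a * cell_proj n b = if a == b then cell_proj n a else 0.
Proof.
rewrite /cell_proj -mulrA [X in _ * X]mulrA cell_orth_ord.
by case: eqVneq => [->|_]; rewrite ?mul1r ?mul0r ?mulr0.
Qed.

Lemma cell_shift n k b : upow k * cell n b = cell n (k + b).
Proof. by rewrite /cell mulrA -(upowD rel). Qed.

Lemma cell_split n b :
  cell_proj n b = cell_proj n.+1 b + cell_proj n.+1 (b + (2 ^ n)%:Z).
Proof.
have [_ _ _ rs] := rel.
have E : cell n.+1 (b + (2 ^ n)%:Z) = upow b * s ^+ n * (u * s).
  rewrite /cell (upowD rel) exprSr -mulrA [upow (2 ^ n)%:Z * _]mulrA.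
  by rewrite -[(2 ^ n)%:Z]mul1r -(sX_upow rel) (upow1 u) !mulrA.
rewrite /cell_proj E /cell exprSr mulrA !starM !mulrA.
rewrite -{1}[upow b * s ^+ n]mulr1 -rs mulrDr !mulrDl !mulrA.
by [].
Qed.

Lemma cell_sum n : \sum_(a < 2 ^ n) cell_proj n a%:Z = 1.
Proof.
elim: n => [|n IH].
  by rewrite big_ord1 /cell_proj /cell (upow0 u) expr0 mulr1 star1 mulr1.
rewrite (_ : (2 ^ n.+1 = 2 ^ n + 2 ^ n)%N); last by rewrite expnS mul2n addnn.
rewrite big_split_ord /= -big_split /= -[RHS]IH; apply: eq_bigr => a _.
by rewrite [RHS]cell_split -PoszD addnC.
Qed.

Definition diag n f : A := \sum_(a < 2 ^ n) f a *: cell_proj n a%:Z.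

Lemma diagM n f g : diag n f * diag n g = diag n (fun a => f a * g a).
Proof.
rewrite /diag mulr_suml; apply: eq_bigr => a _.
rewrite mulr_sumr (bigD1 a) //= big1 ?addr0 => [|b ba].
  by rewrite -scalerAl -scalerAr cell_projM eqxx scalerA.
by rewrite -scalerAl -scalerAr cell_projM eq_sym (negPf ba) !scaler0.
Qed.

Lemma star_diag n f : (diag n f)^* = diag n (fun a => conjc (f a)).
Proof.
by rewrite /diag star_sum; apply: eq_bigr => a _; rewrite starZ star_cell_proj.
Qed.

Lemma diag_cst n : diag n (fun=> 1) = 1.
Proof.
by rewrite -[RHS](cell_sum n); apply: eq_bigr => a _; rewrite scale1r.
Qed.

Lemma eq_diag n f g : (forall a, f a = g a) -> diag n f = diag n g.
Proof. by move=> fg; apply: eq_bigr => a _; rewrite fg. Qed.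

(** [nrm_cosine] applies with the sine [sqrt (1 - f ^ 2)], taken cell by cell. *)
Lemma nrm_diag_real1 n (f : nat -> R) :
  (forall a, (a < 2 ^ n)%N -> `|f a| <= 1) ->
  nrm (diag n (fun a => (f a)%:C)) <= 1.
Proof.
move=> f1; pose g a := Num.sqrt (1 - f a ^+ 2).
apply: (@nrm_cosine _ _ _ (diag n (fun a => (g a)%:C))).
- by rewrite star_diag; apply: eq_diag => a; rewrite conjc_real.
- by rewrite star_diag; apply: eq_diag => a; rewrite conjc_real.
- by rewrite !diagM; apply: eq_diag => a; rewrite mulrC.
rewrite !diagM /diag -big_split /= -[RHS](cell_sum n); apply: eq_bigr => a _.
rewrite -scalerDl -!rmorphM -rmorphD -[RHS]scale1r; congr (_ *: _).
rewrite -!expr2 sqr_sqrtr; first by rewrite addrC subrK.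
by rewrite subr_ge0 -real_normK ?num_real // expr_le1 // f1.
Qed.

Lemma nrm_diag n f (e : R) : 0 < e ->
  (forall a, (a < 2 ^ n)%N -> cabs (f a) <= e) -> nrm (diag n f) <= e.
Proof.
move=> e0 fe; rewrite -(@ler_pXn2r _ 2) ?nnegrE ?nrm_ge0 ?(ltW e0) //.
pose g a := (cabs (f a) / e) ^+ 2.
rewrite -nrm_starM star_diag diagM.
have -> : diag n (fun a => conjc (f a) * f a) =
    (e ^+ 2)%:C *: diag n (fun a => (g a)%:C).
  rewrite /diag scaler_sumr; apply: eq_bigr => a _; rewrite scalerA -rmorphM.
  by rewrite mulrC cabs_sqr -exprMn mulrC divfK // gt_eqF.
rewrite nrmZ cabs_real ger0_norm ?exprn_ge0 ?(ltW e0) // -[leRHS]mulr1.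
rewrite ler_wpM2l ?exprn_ge0 ?(ltW e0) // nrm_diag_real1 // => a an.
rewrite ger0_norm ?exprn_ge0 // ?divr_ge0 ?cabs_ge0 ?(ltW e0) //.
by rewrite expr_le1 ?divr_ge0 ?cabs_ge0 ?(ltW e0) // ler_pdivrMr // mul1r fe.
Qed.

(** The [j]-th power of Sylvester's clock matrix of size [2 ^ m], with [u] in the role of the cyclic
    shift. *)
Definition clock m (j : nat) : A :=
  diag m (fun a => dyroot R m ^ (j%:Z * a%:Z)).

Lemma star_clock m j :
  (clock m j)^* = diag m (fun a => dyroot R m ^ (- (j%:Z * a%:Z))).
Proof. by rewrite star_diag; apply: eq_diag => a; rewrite dyroot_conjX. Qed.

Lemma clock_unitary m j : unitary (clock m j).
Proof.
rewrite /unitary star_clock !diagM; split; rewrite -[RHS](diag_cst m);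
  by apply: eq_diag => a; rewrite -expfzDr ?dyroot_neq0 // ?addNr ?addrN expr0z.
Qed.

Lemma u_clock m j : u * clock m j = dyroot R m ^ (- j%:Z) *: (clock m j * u).
Proof.
have [[uVu uuV] _ _ _] := rel.
have ue b : u * cell_proj m b = cell_proj m (b + 1) * u.
  rewrite /cell_proj [b + 1]addrC -cell_shift (upow1 u) starM -!mulrA.
  by rewrite uVu mulr1.
rewrite /clock /diag mulr_suml scaler_sumr mulr_sumr.
pose F (a : nat) := dyroot R m ^ (j%:Z * a%:Z) *: (cell_proj m a%:Z * u).
(* The index is cyclic: the phase has period [2 ^ m], and moving [upow (2 ^ m)] through [s ^+ m]
   turns it into [u], which cancels in the cell projection. *)
have F0 : F (2 ^ m)%N = F 0.
  rewrite /F; congr (_ *: (_ * _)).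
    have zM : dyroot R m ^ (2 ^ m)%:Z = 1.
      by exact: prim_expr_order (dyroot_prim R m).
    by rewrite mulr0 mulrC -exprz_exp zM exp1rz expr0z.
  rewrite -[X in cell_proj m X]addr0 /cell_proj -cell_shift /cell (upow0 u).
  rewrite mul1r.
  by rewrite -[(2 ^ m)%:Z]mul1r -(sX_upow rel) starM !mulrA
    -[_ * upow 1 * _]mulrA (upow1 u) uuV mulr1.
have shift : \sum_(a < 2 ^ m) F a.+1 = \sum_(a < 2 ^ m) F a.
  have N0 := expn_gt0 2 m; move: F0; case: (2 ^ m)%N N0 => // N _ F0.
  by rewrite big_ord_recr big_ord_recl /= F0 addrC.
transitivity (dyroot R m ^ (- j%:Z) *: \sum_(a < 2 ^ m) F a.+1).
  rewrite scaler_sumr; apply: eq_bigr => a _.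
  rewrite /F -scalerAr ue scalerA -expfzDr ?dyroot_neq0 //.
  by rewrite -(addn1 a) PoszD; congr (_ ^ _ *: _); ring.
by rewrite shift scaler_sumr; apply: eq_bigr => a _; rewrite -scalerAl.
Qed.

Definition clockAd m j (x : A) : A := clock m j * x * (clock m j)^*.

Lemma clockAdD m j : {morph clockAd m j : x y / x + y}.
Proof. by move=> x y; rewrite /clockAd mulrDr mulrDl. Qed.

Lemma clockAdZ m j c x : clockAd m j (c *: x) = c *: clockAd m j x.
Proof. by rewrite /clockAd -scalerAr -scalerAl. Qed.

Lemma clockAdM m j : {morph clockAd m j : x y / x * y}.
Proof.
move=> x y; have [cVc _] := clock_unitary m j.
by rewrite /clockAd !mulrA -[_ * _^* * clock _ _]mulrA cVc mulr1.
Qed.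

Lemma clockAd_contr m j x : nrm (clockAd m j x) <= nrm x.
Proof.
have [cVc _] := clock_unitary m j; have c1 := nrm_isometric cVc.
apply: le_trans (nrmM _ _) _; rewrite nrm_star c1 mulr1.
by apply: le_trans (nrmM _ _) _; rewrite c1 mul1r.
Qed.

Lemma clockAd_upow m j k :
  clockAd m j (upow k) = dyroot R m ^ (j%:Z * k) *: upow k.
Proof.
have [_ ccV] := clock_unitary m j; have [[uVu uuV] _ _ _] := rel.
have z0 := dyroot_neq0 R m.
have ad1 : clockAd m j 1 = 1 by rewrite /clockAd mulr1 ccV.
have adu : clockAd m j u = dyroot R m ^ j%:Z *: u.
  have -> :
      clockAd m j u = dyroot R m ^ j%:Z *: (u * clock m j) * (clock m j)^*.
    by rewrite u_clock scalerA -expfzDr // addrN expr0z scale1r.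
  by rewrite -scalerAl -mulrA ccV mulr1.
have adS l : clockAd m j (upow (l + 1)) =
    dyroot R m ^ j%:Z *: (u * clockAd m j (upow l)).
  by rewrite (upowS rel) clockAdM adu scalerAl.
elim/int_rec: k => [|n IH|n IH].
- by rewrite mulr0 expr0z scale1r (upow0 u) ad1.
- rewrite -addn1 PoszD adS IH -scalerAr scalerA -expfzDr // -(upowS rel).
  by congr (_ ^ _ *: _); ring.
have := adS (- n.+1%:Z); rewrite (_ : - n.+1%:Z + 1 = - n%:Z); last by lia.
rewrite IH => /(congr1 (fun x => dyroot R m ^ (- j%:Z) *: (u^* * x))).
rewrite -!scalerAr !scalerA -!expfzDr // addNr expr0z scale1r.
rewrite [u^* * (u * _)]mulrA uVu mul1r.
move=> <-; rewrite -(upowP rel); congr (_ ^ _ *: upow _); [ring|lia].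
Qed.

(** For [p <= m] each cell projection of level [m] is fixed or killed by the range projection of
    [s ^+ p], which therefore commutes with the clock. *)
Lemma clockAd_range m j p : (p <= m)%N ->
  clockAd m j (s ^+ p * (s ^+ p)^*) = s ^+ p * (s ^+ p)^*.
Proof.
move=> pm; set P := s ^+ p * _.
have Ps : P^* = P by rewrite /P starM starK.
pose g (a : nat) : R[i] := (2 ^ p %| a)%N%:R.
have Pe (a : nat) : P * cell_proj m a%:Z = g a *: cell_proj m a%:Z.
  have := (compress_upow rel) p a%:Z; rewrite /g /= => E.
  have -> : P * cell_proj m a%:Z = s ^+ p * ((s ^+ p)^* * upow a%:Z * s ^+ p)
      * s ^+ (m - p) * (cell m a%:Z)^*.
    by rewrite /P /cell_proj {1}/cell -{1}(subnKC pm) exprD !mulrA.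
  rewrite E; case: ifP => h; last by rewrite mulr0 !mul0r scale0r.
  rewrite -(upow_sX rel) // scale1r /cell_proj {3}/cell.
  by rewrite -[upow _ * s ^+ p * _]mulrA -exprD subnKC.
have eP (a : nat) : cell_proj m a%:Z * P = g a *: cell_proj m a%:Z.
  rewrite -[LHS]starK starM Ps star_cell_proj Pe starZ star_cell_proj.
  by rewrite /g conjc_nat.
have comm : P * clock m j = clock m j * P.
  rewrite /clock /diag mulr_suml mulr_sumr; apply: eq_bigr => a _.
  by rewrite -scalerAr -scalerAl Pe eP.
by rewrite /clockAd -comm -mulrA (clock_unitary m j).2 mulr1.
Qed.

Lemma clockAd_mono j a p c : forall m, (p <= m)%N ->
  clockAd m j (mono u s a p p c) =
    dyroot R m ^ (j%:Z * (a + c)) *: mono u s a p p c.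
Proof.
move=> m pm; rewrite /mono -[upow a * _ * _]mulrA 2!clockAdM clockAd_range //.
rewrite !clockAd_upow -!scalerAl -!scalerAr scalerA -expfzDr ?dyroot_neq0 //.
by rewrite -mulrDr.
Qed.

(** The mean over [j] cancels the off-diagonal blocks by orthogonality of characters, as distinct
    [a, b] below [2 ^ m] are incongruent. *)
Lemma clockAd_pinch m x :
  fourier clockAd 0 m x =
    \sum_(a < 2 ^ m) cell_proj m a%:Z * x * cell_proj m a%:Z.
Proof.
have M0 : (2 ^ m)%:R != 0 :> R[i] by rewrite pnatr_eq0 -lt0n expn_gt0.
rewrite /fourier.
have E j : dyroot R m ^ (- (j%:Z * 0)) *: clockAd m j x =
   \sum_(a < 2 ^ m) \sum_(b < 2 ^ m) dyroot R m ^ (j%:Z * (a%:Z - b%:Z)) *: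
     (cell_proj m a%:Z * x * cell_proj m b%:Z).
  rewrite mulr0 oppr0 expr0z scale1r /clockAd star_clock /clock /diag !mulr_suml.
  apply: eq_bigr => a _; rewrite mulr_sumr; apply: eq_bigr => b _.
  rewrite -scalerAr -!scalerAl scalerA -expfzDr ?dyroot_neq0 //.
  by congr (_ ^ _ *: _); ring.
under eq_bigr do rewrite E.
rewrite exchange_big /= scaler_sumr; apply: eq_bigr => a _.
rewrite exchange_big /= (bigD1 a) //= [X in _ + X]big1 => [|b ba].
  under eq_bigr do rewrite subrr mulr0 expr0z scale1r.
  rewrite sumr_const card_ord addr0 -[X in _ *: X = _]scaler_nat scalerA.
  by rewrite mulVf // scale1r.
rewrite -scaler_suml dyroot_sum.
case: ifP => [/dvdn_leq|_]; last by rewrite scale0r.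
by move: ba; rewrite -val_eqE /=; have := ltn_ord a; have := ltn_ord b; lia.
Qed.

End Diagonal.

(** * Density of the monomials *)

Section StarMorphismComp.
Variables (R : realType) (A B C : cstarAlgType R).
Variables (f : starMorphism B C) (g : starMorphism A B).

Definition star_comp (x : A) : C := f (g x).

Fact star_comp_linear : linear star_comp.
Proof. by move=> a x y; rewrite /star_comp !linearP. Qed.
HB.instance Definition _ :=
  GRing.isLinear.Build R[i] A C *:%R star_comp star_comp_linear.

Fact star_comp_monoid : monoid_morphism star_comp.
Proof. by split=> [|x y]; rewrite /star_comp ?rmorph1 ?rmorphM. Qed.
HB.instance Definition _ :=
  GRing.isMonoidMorphism.Build A C star_comp star_comp_monoid.

Fact star_comp_star x : star_comp x^* = (star_comp x)^*.
Proof. by rewrite /star_comp !rmorph_star. Qed.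
HB.instance Definition _ := isStarMorphism.Build R A C star_comp star_comp_star.

End StarMorphismComp.

Lemma Q2_relations_morph (R : realType) (A B : cstarAlgType R)
  (f : starMorphism A B) (u s : A) :
  Q2_relations u s -> Q2_relations (f u) (f s).
Proof.
case=> [[uVu uuV] sVs su rs]; split.
- by split; rewrite -rmorph_star -rmorphM ?uVu ?uuV rmorph1.
- by rewrite /isometric -rmorph_star -rmorphM sVs rmorph1.
- by rewrite -rmorphXn -!rmorphM su.
- by rewrite -!rmorph_star -!rmorphM -rmorphD rs rmorph1.
Qed.

(** Used twice: for the inclusion of the closed span, and for an injective endomorphism that is to
    be inverted. *)
Lemma Q2_relations_reflect (R : realType) (A B : cstarAlgType R)
  (f : starMorphism A B) (u s : A) : injective f ->
  Q2_relations (f u) (f s) -> Q2_relations u s.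
Proof.
move=> fI [[uVu uuV] sVs su rs]; split.
- by split; apply: fI; rewrite rmorphM /= rmorph_star rmorph1.
- by apply: fI; rewrite rmorphM /= rmorph_star rmorph1.
- by apply: fI; rewrite !rmorphM.
- by apply: fI; rewrite rmorphD !rmorphM /= !rmorph_star rmorph1.
Qed.

Section Universal.
Variables (R : realType) (Q2 : cstarAlgType R) (u s : Q2).
Hypothesis hQ2 : is_Q2 u s.

Let rel : Q2_relations u s := hQ2.1.

Lemma Q2_ext (B : cstarAlgType R) (f g : starMorphism Q2 B) :
  f u = g u -> f s = g s -> f = g.
Proof.
move=> fgu fgs.
have [h [_ hu]] := hQ2.2 B _ _ (Q2_relations_morph f rel).
by rewrite -(hu f) // -(hu g).
Qed.

Definition Q2_lift (B : cstarAlgType R) (v t : B) (h : Q2_relations v t) :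
  starMorphism Q2 B := sval (cid (hQ2.2 B v t h)).

Lemma Q2_lift_u B v t h : @Q2_lift B v t h u = v.
Proof. by rewrite /Q2_lift; case: cid => f [[]]. Qed.

Lemma Q2_lift_s B v t h : @Q2_lift B v t h s = t.
Proof. by rewrite /Q2_lift; case: cid => f [[]]. Qed.

Definition monomial (t : int * nat * nat * int) : Q2 :=
  let: (a, p, q, b) := t in mono u s a p q b.

Definition span_eval (l : seq (R[i] * (int * nat * nat * int))) : Q2 :=
  \sum_(t <- l) t.1 *: monomial t.2.

Definition in_span x := exists l, x = span_eval l.

Lemma span0 : in_span 0.
Proof. by exists [::]; rewrite /span_eval big_nil. Qed.

Lemma spanD x y : in_span x -> in_span y -> in_span (x + y).
Proof.
by move=> [l ->] [l' ->]; exists (l ++ l'); rewrite /span_eval big_cat.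
Qed.

Lemma spanZ c x : in_span x -> in_span (c *: x).
Proof.
move=> [l ->]; exists [seq (c * t.1, t.2) | t <- l].
rewrite /span_eval big_map scaler_sumr.
by apply: eq_bigr => t _; rewrite scalerA.
Qed.

Lemma span_mono a p q b : in_span (mono u s a p q b).
Proof.
by exists [:: (1, (a, p, q, b))]; rewrite /span_eval big_seq1 scale1r.
Qed.

Lemma span_linear (f : Q2 -> Q2) :
  (forall c x y, f (c *: x + y) = c *: f x + f y) ->
  (forall a p q b, in_span (f (mono u s a p q b))) ->
  forall x, in_span x -> in_span (f x).
Proof.
move=> fL fm _ [l ->]; elim: l => [|[c [[[a p] q] b]] l IH].
  rewrite /span_eval big_nil; suff -> : f 0 = 0 by exact: span0.
  by have := fL (-1) 0 0; rewrite scaler0 addr0 scaleN1r addNr.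
by rewrite /span_eval big_cons fL; apply: spanD => //; apply: spanZ; exact: fm.
Qed.

(** Left multiplication by powers of [u], by [s] and by [s^*] preserves the span, and every monomial
    is a product of such factors. *)
Lemma span_mul x y : in_span x -> in_span y -> in_span (x * y).
Proof.
move=> hx hy; have lmul z : (forall a p q b, in_span (z * mono u s a p q b)) ->
    forall y, in_span y -> in_span (z * y).
  by move=> hz; apply: span_linear => // c v w; rewrite mulrDr -scalerAr.
have lu k : forall y, in_span y -> in_span (upow u k * y).
  by apply: lmul => a p q b; rewrite (upow_mono rel); exact: span_mono.
have ls : forall y, in_span y -> in_span (s * y).
  by apply: lmul => a p q b; rewrite (s_mono rel); exact: span_mono.
have lsV : forall y, in_span y -> in_span (s^* * y).
  apply: lmul => a p q b.
  have [->|[a' [p' [q' [b' ->]]]]] := sV_mono rel a p q b; first exact: span0.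
  exact: span_mono.
suff h : in_span ((fun x => x * y) x) by [].
apply: (@span_linear (fun x => x * y)) hx => [c v w|a p q b].
  by rewrite mulrDl -scalerAl.
rewrite /mono -!mulrA; apply: (lu).
have lsp : forall y, in_span y -> in_span (s ^+ p * y).
  elim: p => [|p IH] w hw; first by rewrite expr0 mul1r.
  by rewrite exprS -mulrA; apply: ls; apply: IH.
have lsVq : forall y, in_span y -> in_span ((s ^+ q)^* * y).
  elim: q => [|q IH] w hw; first by rewrite expr0 star1 mul1r.
  by rewrite exprSr starM -mulrA; apply: lsV; apply: IH.
exact/lsp/lsVq/lu.
Qed.

Lemma span_star x : in_span x -> in_span x^*.
Proof.
move=> [l ->]; rewrite /span_eval star_sum.
elim: l => [|[c [[[a p] q] b]] l IH]; first by rewrite big_nil; exact: span0.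
rewrite big_cons; apply: spanD => //=; rewrite starZ star_mono.
by apply: spanZ; exact: span_mono.
Qed.

Definition span_closure (x : Q2) :=
  forall e : R, 0 < e -> exists2 y, in_span y & nrm (x - y) < e.

Lemma span_closure_incl x : in_span x -> span_closure x.
Proof. by move=> hx e e0; exists x; rewrite // subrr nrm0. Qed.

Lemma span_closure_lin (a : R[i]) x y :
  span_closure x -> span_closure y -> span_closure (a *: x + y).
Proof.
move=> hx hy e e0; have a0 := cabs_ge0 a.
have d0 : 0 < e / 2 / (cabs a + 1) by rewrite !divr_gt0 // ltr_wpDl.
have e20 : 0 < e / 2 by rewrite divr_gt0.
have [x' sx hx'] := hx _ d0; have [y' sy hy'] := hy _ e20.
exists (a *: x' + y'); first by apply: spanD => //; exact: spanZ.
rewrite opprD addrACA -scalerBr; apply: le_lt_trans (nrmD _ _) _; rewrite nrmZ.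
move: hx'; rewrite ltr_pdivlMr ?ltr_wpDl // => hx'.
have := nrm_ge0 (x - x'); lra.
Qed.

Lemma span_closure_mul x y :
  span_closure x -> span_closure y -> span_closure (x * y).
Proof.
move=> hx hy e e0; have e20 : 0 < e / 2 by rewrite divr_gt0.
have d0 : 0 < e / 2 / (nrm x + 1) by rewrite !divr_gt0 // ltr_wpDl ?nrm_ge0.
have [y' sy hy'] := hy _ d0.
have d1 : 0 < e / 2 / (nrm y' + 1) by rewrite !divr_gt0 // ltr_wpDl ?nrm_ge0.
have [x' sx hx'] := hx _ d1.
exists (x' * y'); first exact: span_mul.
have -> : x * y - x' * y' = x * (y - y') + (x - x') * y'.
  by rewrite mulrBr mulrBl subrKA.
move: hx' hy'; rewrite !ltr_pdivlMr ?ltr_wpDl ?nrm_ge0 //.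
have := nrmD (x * (y - y')) ((x - x') * y').
have := nrmM x (y - y'); have := nrmM (x - x') y'.
have := nrm_ge0 (y - y'); have := nrm_ge0 (x - x'); lra.
Qed.

Lemma span_closure_star x : span_closure x -> span_closure x^*.
Proof.
move=> hx e /hx[y sy hy]; exists y^*; first exact: span_star.
by rewrite -starB nrm_star.
Qed.

Lemma span_closure_closed x :
  (forall e : R, 0 < e -> exists2 y, span_closure y & nrm (x - y) < e) ->
  span_closure x.
Proof.
move=> hx e e0; have e20 : 0 < e / 2 by rewrite divr_gt0.
have [y hy xy] := hx _ e20; have [w sw yw] := hy _ e20.
by exists w => //; have := nrmD (x - y) (y - w); rewrite subrKA; lra.
Qed.

Lemma span_one : in_span 1.
Proof.
rewrite (_ : 1 = mono u s 0 0 0 0); first exact: span_mono.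
by rewrite /mono expr0 star1 (upow0 u) !mulr1.
Qed.

Definition span_sub : cstarSub Q2 := CstarSub (span_closure_incl span_one)
  span_closure_lin span_closure_mul span_closure_star span_closure_closed.

Lemma span_dense x : span_closure x.
Proof.
have su : span_closure u.
  apply: span_closure_incl; rewrite (_ : u = mono u s 1 0 0 0).
    exact: span_mono.
  by rewrite /mono expr0 star1 (upow0 u) (upow1 u) !mulr1.
have ss : span_closure s.
  apply: span_closure_incl; rewrite (_ : s = mono u s 0 1 0 0).
    exact: span_mono.
  by rewrite /mono expr0 expr1 star1 (upow0 u) !mulr1 mul1r.
have [v hv] := @sub_incl_surj _ _ span_sub _ su.
have [t ht] := @sub_incl_surj _ _ span_sub _ ss.
pose incl : starMorphism (sub_cstar span_sub) Q2 := @sub_incl _ _ span_sub.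
have relB : Q2_relations v t.
  apply: (@Q2_relations_reflect _ _ _ incl); first exact: sub_incl_inj.
  by rewrite /incl /= hv ht.
(* The lift into the closed span followed by the inclusion fixes both generators, hence is the
   identity; so every [x] lies in the closed span. *)
have E : star_comp incl (Q2_lift relB) = end_id Q2 :> (starMorphism Q2 Q2).
  by apply: Q2_ext; rewrite /= /star_comp ?Q2_lift_u ?Q2_lift_s.
have := @sub_inclP _ _ span_sub (Q2_lift relB x).
have /(congr1 (fun f : starMorphism Q2 Q2 => f x)) /= := E.
by rewrite /star_comp /= => ->.
Qed.

End Universal.

(** * Injectivity of the star-morphisms from the algebra *)

Section Simplicity.
Variables (R : realType) (Q2 : cstarAlgType R) (u s : Q2).
Hypothesis hQ2 : is_Q2 u s.

Let rel : Q2_relations u s := hQ2.1.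
Local Notation z := (dyroot R).
Local Notation span_eval := (span_eval u s).
Local Notation monomial := (monomial u s).
Local Notation term := (R[i] * (int * nat * nat * int))%type.

Lemma gauge_relations (w : R[i]) : w * conjc w = 1 -> Q2_relations u (w *: s).
Proof.
move=> wu; have [uu sVs su rs] := rel; split=> //.
- by rewrite /isometric starZ -scalerAl -scalerAr scalerA mulrC wu scale1r.
- by rewrite -scalerAl su scalerAr.
rewrite starZ -!(scalerAr, scalerAl) !scalerA.
by rewrite -[_ * u^*]scalerAl !scalerA ?[conjc w * w]mulrC wu !scale1r.
Qed.

Lemma dyroot_expX_unit m (j : nat) : z m ^ j%:Z * conjc (z m ^ j%:Z) = 1.
Proof. by rewrite dyroot_conjX -expfzDr ?dyroot_neq0 // subrr expr0z. Qed.

Definition gauge m j : starMorphism Q2 Q2 :=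
  Q2_lift hQ2 (gauge_relations (dyroot_expX_unit m j)).

Lemma gauge_upow m j k : gauge m j (upow u k) = upow u k.
Proof.
have gu : gauge m j u = u by rewrite /gauge Q2_lift_u.
by case: k => n; rewrite /= rmorphXn ?rmorph_star /= ?rmorph_star gu.
Qed.

Lemma gauge_sX m j n : gauge m j (s ^+ n) = z m ^ (j%:Z * n%:Z) *: s ^+ n.
Proof. by rewrite rmorphXn /= /gauge Q2_lift_s exprZn -exprz_exp. Qed.

Lemma gauge_sXV m j n :
  gauge m j (s ^+ n)^* = z m ^ (j%:Z * - n%:Z) *: (s ^+ n)^*.
Proof. by rewrite rmorph_star gauge_sX starZ dyroot_conjX mulrN. Qed.

Lemma gauge_mono m j a p q b : gauge m j (mono u s a p q b) =
  z m ^ (j%:Z * (p%:Z - q%:Z)) *: mono u s a p q b.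
Proof.
rewrite /mono !rmorphM /= !gauge_upow gauge_sX gauge_sXV.
rewrite -!(scalerAr, scalerAl) !scalerA -expfzDr ?dyroot_neq0 //.
by congr (_ ^ _ *: _); ring.
Qed.

Let gD m j : {morph gauge m j : x y / x + y}. Proof. exact: rmorphD. Qed.
Let gM m j : {morph gauge m j : x y / x * y}. Proof. exact: rmorphM. Qed.
Let gC m j x : nrm (gauge m j x) <= nrm x.
Proof. exact: starmorph_contraction. Qed.

Local Notation gaugeF := (fourier (fun m j x => gauge m j x)).
Local Notation clockF := (fourier (clockAd u s)).

Definition deg0 (l : seq term) := [seq t <- l | t.2.1.1.2 == t.2.1.2].

Definition term_coef (t : term) (b : int) : R[i] :=
  let: (c, (a, p, q, d)) := t in c * diag_coef R a p q d b.

Definition span_coef (l : seq term) (b : int) : R[i] :=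
  \sum_(t <- l) term_coef t b.

Lemma pow2_dvd_small (k : int) m :
  (absz k <= m)%N -> (2 ^ m %| absz k)%N = (k == 0).
Proof.
move=> km; case: eqVneq => [->|k0]; first by rewrite dvdn0.
rewrite gtnNdvd //; first by rewrite lt0n absz_eq0.
exact: leq_ltn_trans km (ltn_expl _ _).
Qed.

(** Exact for large [m]: once [m] dominates every [|p - q|], the mean separates degree 0 from the
    other degrees. *)
Lemma gaugeF_span l : exists m0, forall m, (m0 <= m)%N ->
  gaugeF 0 m (span_eval l) = span_eval (deg0 l).
Proof.
elim: l => [|[c [[[a p] q] b]] l [m0 IH]].
  exists 0%N => m _; rewrite /deg0 /= /span_eval big_nil.
  rewrite /fourier big1 ?scaler0 // => j _.
  by rewrite raddf0 scaler0.
exists (maxn m0 (p + q)) => m; rewrite geq_max => /andP[/IH IHm pqm].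
rewrite /span_eval big_cons fourierD //= -/(span_eval l) IHm.
rewrite (@fourier_eigen _ _ _ 0 (p%:Z - q%:Z)); last first.
  by move=> j; rewrite linearZ /= gauge_mono !scalerA mulrC.
rewrite subr0 pow2_dvd_small ?subr_eq0; last by lia.
rewrite eqz_nat /deg0 /=; case: eqP => _; last by rewrite scale0r add0r.
by rewrite /span_eval big_cons scale1r.
Qed.

Lemma gaugeF_approx y (e : R) : 0 < e -> exists2 l, nrm (y - span_eval l) < e &
  exists m0, forall m, (m0 <= m)%N ->
    nrm (gaugeF 0 m y - span_eval (deg0 l)) < e.
Proof.
move=> e0; have [_ [l ->] hl] := span_dense hQ2 y e0; exists l => //.
have [m0 hm] := gaugeF_span l; exists m0 => m /hm <-.
have -> : gaugeF 0 m y - gaugeF 0 m (span_eval l) =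
    gaugeF 0 m (y - span_eval l).
  by apply/eqP; rewrite subr_eq -fourierD // subrK.
exact: le_lt_trans (fourier_contr gC _ _ _) hl.
Qed.

(** The limit is the conditional expectation of [y] onto the gauge-invariant part. It exists because
    the means are eventually within any [e] of a fixed element of the span. *)
Lemma gaugeF_lim y : exists w, tends0 (fun m => gaugeF 0 m y - w).
Proof.
apply: nrm_cauchy => e e0; have e20 : 0 < e / 2 by rewrite divr_gt0.
have [l _ [m0 hm]] := gaugeF_approx y e20; exists m0 => m m0m.
have := hm m m0m; have := hm m0 (leqnn _).
set v := span_eval (deg0 l).
have := nrmB (gaugeF 0 m y - v) (gaugeF 0 m0 y - v).
by rewrite opprB subrKA; lra.
Qed.

Lemma gaugeF_lim_approx y w (e : R) :
  tends0 (fun m => gaugeF 0 m y - w) -> 0 < e ->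
  exists2 l, nrm (y - span_eval l) < e & nrm (w - span_eval (deg0 l)) < e.
Proof.
move=> yw e0; have e20 : 0 < e / 2 by rewrite divr_gt0.
have [l yl [m0 hm]] := gaugeF_approx y e20; exists l; first by lra.
have [m1 h1] := yw _ e20.
have := hm _ (leq_maxl m0 m1); have := h1 _ (leq_maxr m0 m1).
set f := gaugeF _ _ _; have := nrmB (f - span_eval (deg0 l)) (f - w).
by rewrite opprB addrC subrKA; lra.
Qed.

(** Large [b] avoid the fixed points of the monomials with [p != q]; the scale [M0] may depend on
    [b]. *)
Lemma compress_span l : exists B : nat, forall b : nat, (B <= b)%N ->
  exists M0, forall M, (M0 <= M)%N ->
  (cell u s M b)^* * span_eval l * cell u s M b = span_coef l b *: 1.
Proof.
elim: l => [|[c [[[a p] q] d]] l [B IH]].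
  exists 0%N => b _; exists 0%N => M _.
  by rewrite /span_eval /span_coef !big_nil mulr0 mul0r scale0r.
have [B' hB'] : exists B' : nat, forall b : nat, (B' <= b)%N ->
    exists M0, forall M, (M0 <= M)%N ->
    (cell u s M b)^* * mono u s a p q d * cell u s M b =
    diag_coef R a p q d b *: 1.
  have [<-|pq] := eqVneq p q.
    have [M0 hM] := compress_diag rel a p d.
    by exists 0%N => b _; exists M0 => M hM0; exact: hM.
  have [B' hB'] := compress_offdiag rel a d pq.
  exists B' => b /hB'[M0 hM]; exists M0 => M /hM ->.
  by rewrite /diag_coef (negPf pq) scale0r.
exists (maxn B B') => b; rewrite geq_max => /andP[/IH[M1 h1] /hB'[M2 h2]].
exists (maxn M1 M2) => M; rewrite geq_max => /andP[/h1 + /h2].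
rewrite /span_eval /span_coef !big_cons /= => e1 e2.
rewrite mulrDr mulrDl e1 -scalerAr -scalerAl e2 scalerA.
by rewrite -scalerDl.
Qed.

(** In degree 0 there are no isolated fixed points to avoid, so every [b] is allowed and one scale
    serves for all. *)
Lemma compress_span_deg0 l : exists M0, forall M b, (M0 <= M)%N ->
  (cell u s M b)^* * span_eval (deg0 l) * cell u s M b = span_coef l b *: 1.
Proof.
elim: l => [|[c [[[a p] q] d]] l [M1 IH]].
  exists 0%N => M b _.
  by rewrite /span_eval /span_coef !big_nil mulr0 mul0r scale0r.
rewrite /deg0 /= -/(deg0 l); case: eqVneq => [<-|pq].
  have [M2 h2] := compress_diag rel a p d.
  exists (maxn M1 M2) => M b; rewrite geq_max => /andP[h1 /h2 e2].
  have := IH M b h1; rewrite /span_eval /span_coef !big_cons /= => e1.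
  by rewrite mulrDr mulrDl e1 -scalerAr -scalerAl e2 scalerA -scalerDl.
exists M1 => M b hM; rewrite IH // /span_coef big_cons /= /diag_coef (negPf pq).
by rewrite mulr0 add0r.
Qed.

(** This lets a coefficient be read off at a large index of the same residue class, where
    [compress_span] applies. *)
Lemma span_coef_periodic l : exists m0, forall m (a k : nat), (m0 <= m)%N ->
  span_coef l (a + 2 ^ m * k)%N = span_coef l a.
Proof.
elim: l => [|[c [[[a p] q] d]] l [m0 IH]].
  by exists 0%N => m a k _; rewrite /span_coef !big_nil.
exists (maxn m0 p) => m a' k; rewrite geq_max => /andP[/IH e pm].
rewrite /span_coef !big_cons -!/(span_coef l _) e /= /diag_coef.
congr (c * (_ && _)%:R + _).
have h : ((2 ^ p)%N%:Z %| (2 ^ m * k)%N%:Z)%Z.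
  by rewrite dvdzE /= -(subnKC pm) expnD -mulnA dvdn_mulr.
by rewrite PoszD addrA; have := rpredDr (d + a'%:Z) h; rewrite !dvdzE.
Qed.

Variables (B : cstarAlgType R) (phi : starMorphism Q2 B).

Lemma clockF_gaugeF_small y w : phi y = 0 ->
  tends0 (fun m => gaugeF 0 m y - w) -> tends0 (fun m => clockF 0 m w).
Proof.
move=> y0 yw e e0.
have e40 : 0 < e / 4 by rewrite divr_gt0.
have [l yl wl] := gaugeF_lim_approx yw e40.
have [m0 per] := span_coef_periodic l.
have [m1 comp0] := compress_span_deg0 l.
(* At a large index [b] congruent to [a], the coefficient is a compression of [span_eval l] by an
   isometry. Applying [phi] bounds it by the norm of [phi (span_eval l)], hence by the distance from
   [span_eval l] to [y]. *)
have coef_le m (a : nat) : (m0 <= m)%N -> cabs (span_coef l a) <= e / 4.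
  move=> m0m; have [N hN] := compress_span l.
  rewrite -(per m a N m0m); set b := (a + _)%N.
  have [|M /(_ M (leqnn _)) hM] := hN b.
    by rewrite /b (leq_trans _ (leq_addl _ _)) // leq_pmull // expn_gt0.
  have c1 : nrm (phi (cell u s M b)) = 1.
    apply: nrm_isometric; rewrite /isometric -rmorph_star -rmorphM.
    by rewrite (cell_isometric rel) rmorph1.
  move: (cell u s M b) hM c1 => r hM c1.
  have := congr1 phi hM; rewrite linearZ rmorph1 !rmorphM /= rmorph_star.
  move=> /(congr1 (@nrm _ _)); rewrite nrmZ nrm1 mulr1 => <-.
  apply: le_trans (nrmM _ _) _; rewrite c1 mulr1.
  apply: le_trans (nrmM _ _) _; rewrite nrm_star c1 mul1r.
  rewrite -nrmN -[- _]add0r -y0 -rmorphB.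
  by apply: le_trans (starmorph_contraction _ _) _; exact: ltW.
exists (maxn m0 m1) => m; rewrite geq_max => /andP[m0m m1m].
have E : clockF 0 m (span_eval (deg0 l)) = diag u s m (fun a => span_coef l a).
  rewrite clockAd_pinch; apply: eq_bigr => a _.
  rewrite /cell_proj; move: (comp0 m a%:Z m1m); move: (cell u s m a%:Z) => r rc.
  have -> : r * r^* * span_eval (deg0 l) * (r * r^*) =
      r * (r^* * span_eval (deg0 l) * r) * r^* by rewrite !mulrA.
  by rewrite rc -scalerAr mulr1 -scalerAl.
have : nrm (clockF 0 m (span_eval (deg0 l))) <= e / 4.
  by rewrite E; apply: (nrm_diag rel) => // a _; exact: coef_le.
have := fourier_contr (clockAd_contr rel) 0 m (w - span_eval (deg0 l)).
set v := span_eval (deg0 l).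
have := nrmD (clockF 0 m (w - v)) (clockF 0 m v).
rewrite -(fourierD (clockAdD u s)) subrK; lra.
Qed.

(** All clock coefficients of the limit [w] tend to 0: the [k]-th one is, up to a power of [u], the
    0-th one of [w * upow u (- k)], which is the gauge limit of [y * upow u (- k)], again in the
    kernel of [phi]. *)
Lemma gaugeF0_small y : phi y = 0 -> tends0 (fun m => gaugeF 0 m y).
Proof.
move=> y0; have [w yw] := gaugeF_lim y.
suff w0 : w = 0 by move: yw; rewrite w0; apply: tends0_le => m; rewrite subr0.
apply: (fejer_uniqueness (clockAdD u s) (clockAd_contr rel)) => [e e0|k].
  have [l _ wl] := gaugeF_lim_approx yw e0.
  exists [seq t.1 *: monomial t.2 | t <- deg0 l]; last by rewrite big_map.
  move=> v /mapP[[c [[[a p] q] b]]].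
  rewrite mem_filter /= => /andP[/eqP <- _] ->.
  exists (a + b), p => m pm j.
  by rewrite clockAdZ (clockAd_mono rel) // !scalerA mulrC.
pose f m := clockF 0 m (w * upow u (- k)).
have fE m : clockF k m w = f m * upow u k.
  rewrite -{1}[w]mulr1 -(upowN_l rel k) mulrA.
  rewrite (@fourier_mulr _ _ _ (clockAdM rel) _ k) ?subrr // => j.
  exact: (clockAd_upow rel).
have nu k' : nrm (upow u k') = 1.
  by apply: nrm_isometric; rewrite /isometric star_upow (upowN_l rel).
apply: (@tends0_le _ _ _ f) => [m|].
  by rewrite fE; have := nrmM (f m) (upow u k); rewrite nu mulr1.
apply: (@clockF_gaugeF_small (y * upow u (- k))).
  by rewrite rmorphM /= y0 mul0r.
apply: tends0_le yw => m.
rewrite (@fourier_mulr _ _ _ gM _ 0); last first.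
  by move=> j; rewrite mulr0 expr0z scale1r gauge_upow.
rewrite subr0 -mulrBl; have := nrmM (gaugeF 0 m y - w) (upow u (- k)).
by rewrite nu mulr1.
Qed.

(** Nonnegative degrees are brought to 0 by [(s ^+ n)^*] on the right, negative ones by a power of
    [s] on the left. On these sides the isometry relation undoes the multiplication. *)
Lemma gaugeF_small y k : phi y = 0 -> tends0 (fun m => gaugeF k m y).
Proof.
move=> y0; have sn n : nrm (s ^+ n) = 1.
  by apply: nrm_isometric; rewrite /isometric (sXVsX rel).
case: k => n.
  have y0' : phi (y * (s ^+ n)^*) = 0 by rewrite rmorphM /= y0 mul0r.
  move: (gaugeF0_small y0'); apply: tends0_le => m.
  rewrite (@fourier_mulr _ _ _ gM _ (- n%:Z)); last first.
    by move=> j; exact: gauge_sXV.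
  rewrite sub0r opprK -{1}[gaugeF n m y]mulr1 -(sXVsX rel n) mulrA.
  by apply: le_trans (nrmM _ _) _; rewrite sn mulr1.
have y0' : phi (s ^+ n.+1 * y) = 0 by rewrite rmorphM /= y0 mulr0.
rewrite NegzE; move: (gaugeF0_small y0'); apply: tends0_le => m.
rewrite (@fourier_mull _ _ _ gM _ n.+1%:Z); last by move=> j; exact: gauge_sX.
rewrite sub0r -{1}[gaugeF _ m y]mul1r -(sXVsX rel n.+1) -mulrA.
by apply: le_trans (nrmM _ _) _; rewrite nrm_star sn mul1r.
Qed.

Theorem Q2_morphism_injective : injective phi.
Proof.
move=> x x' /eqP; rewrite -subr_eq0 -rmorphB => /eqP y0.
apply/eqP; rewrite -subr_eq0; apply/eqP; move: (x - x') y0 => y y0.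
apply: (fejer_uniqueness gD gC) => [e e0|k]; last exact: gaugeF_small.
have [_ [l ->] hl] := span_dense hQ2 y e0.
exists [seq t.1 *: monomial t.2 | t <- l]; last by rewrite big_map.
move=> v /mapP[[c [[[a p] q] b]]] _ ->; exists (p%:Z - q%:Z), 0%N => m _ j.
by rewrite linearZ /= gauge_mono !scalerA mulrC.
Qed.

End Simplicity.

(** * The monoid of endomorphisms *)

Section Endomorphisms.
Variables (R : realType) (Q2 : cstarAlgType R) (u s : Q2).
Hypothesis hQ2 : is_Q2 u s.

Let rel : Q2_relations u s := hQ2.1.
Let uVu : u^* * u = 1. Proof. by case: rel => -[]. Qed.
Let sVs : s^* * s = 1. Proof. by case: rel. Qed.
Let range_sum : s * s^* + u * s * (u * s)^* = 1.
Proof. by case: rel => _ _ _; rewrite starM !mulrA. Qed.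
Let s1Vs1 : (u * s)^* * (u * s) = 1.
Proof. by rewrite starM -mulrA [u^* * _]mulrA uVu mul1r sVs. Qed.
Let sVs1 : s^* * (u * s) = 0. Proof. by rewrite mulrA (sVus rel). Qed.
Let s1Vs : (u * s)^* * s = 0.
Proof. by rewrite -[LHS]starK starM starK sVs1 star0. Qed.

(** Together with [Wu_s1] this tests the intertwining relation on the two isometries: it then reads
    [U V s2 = V s1] and [U V s1 = V s2 U]. *)
Lemma Wu_s U : Wu u s U * s = u * s.
Proof. by rewrite /Wu mulrDl -!mulrA sVs s1Vs !mulr0 addr0 mulr1. Qed.

Lemma Wu_s1 U : Wu u s U * (u * s) = s * U.
Proof.
by rewrite /Wu mulrDl -[_ * s^* * _]mulrA sVs1 mulr0 add0r -mulrA s1Vs1 mulr1.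
Qed.

Lemma S_Q2_relations p : S_Q2 u s p -> Q2_relations p.1 (p.2 * s).
Proof.
case: p => U V /= [[UVU UUV] [VVV VVV'] UV]; rewrite /intertwiners /= in UV.
have UVs : U * (V * s) = V * (u * s) by rewrite mulrA UV -mulrA Wu_s.
have UVs1 : U * (V * (u * s)) = V * (s * U) by rewrite mulrA UV -mulrA Wu_s1.
split=> //.
- by rewrite /isometric starM -mulrA [V^* * _]mulrA VVV mul1r.
- by rewrite expr2 -[RHS]mulrA UVs UVs1 mulrA.
have -> : U * (V * s) * (V * s)^* * U^* = V * (u * s) * (V * (u * s))^*.
  by rewrite -UVs [in RHS]starM !mulrA.
by rewrite -VVV' -{5}(mulr1 V) -range_sum mulrDr mulrDl !starM !mulrA.
Qed.

Definition lambda (p : S_Q2 u s) : End Q2 :=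
  Q2_lift hQ2 (S_Q2_relations (set_valP p)).

Lemma lambda_u p : lambda p u = (set_val p).1.
Proof. by rewrite /lambda Q2_lift_u. Qed.

Lemma lambda_s p : lambda p s = (set_val p).2 * s.
Proof. by rewrite /lambda Q2_lift_s. Qed.

Lemma lambda_s1 p : lambda p (u * s) = (set_val p).2 * (u * s).
Proof.
rewrite rmorphM /= lambda_u lambda_s.
have [_ _ /= UV] := set_valP p; rewrite /intertwiners /= in UV.
by rewrite mulrA UV -mulrA Wu_s.
Qed.

Lemma is_lambdaP p (phi : End Q2) :
  is_lambda u s (set_val p).1 (set_val p).2 phi <-> phi = lambda p.
Proof.
split=> [[phiu _ phis]|->].
  by apply: (Q2_ext hQ2); rewrite ?lambda_u ?lambda_s.
by split; rewrite ?lambda_u ?lambda_s1 ?lambda_s.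
Qed.

(** The second component is the only [V] with [V * s = phi s] and [V * (u * s) = phi (u * s)], by
    [eq_on_isometries]. *)
Definition symbol (phi : End Q2) : Q2 * Q2 :=
  (phi u, phi s * s^* + phi (u * s) * (u * s)^*).

Lemma symbol2_s phi : (symbol phi).2 * s = phi s.
Proof. by rewrite mulrDl -!mulrA sVs s1Vs !mulr0 addr0 mulr1. Qed.

Lemma symbol2_s1 phi : (symbol phi).2 * (u * s) = phi (u * s).
Proof.
by rewrite mulrDl -[X in X + _]mulrA sVs1 mulr0 add0r -mulrA s1Vs1 mulr1.
Qed.

Lemma eq_on_isometries (x y : Q2) :
  x * s = y * s -> x * (u * s) = y * (u * s) -> x = y.
Proof.
move=> xys xys1; rewrite -[x]mulr1 -[y]mulr1 -range_sum !mulrDr !(mulrA _ s).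
by rewrite xys !(mulrA _ (u * s)) xys1.
Qed.

(** Checked on the two isometries, the intertwining relation is the image under [phi] of [s1 = u s2]
    and of [s2 u = u^2 s2]. *)
Lemma symbol_S (phi : End Q2) : S_Q2 u s (symbol phi).
Proof.
have [[UVU UUV] tVt _ rs] := Q2_relations_morph phi rel.
have V1 : (symbol phi).2 * (symbol phi).2^* = 1.
  rewrite {2}/symbol /= starD !(starM _ _^*) !starK mulrDr !mulrA -(mulrA _ u s).
  by rewrite symbol2_s symbol2_s1 -!rmorph_star -!rmorphM -rmorphD
    range_sum rmorph1.
have phiM (x y : Q2) : (phi x)^* * phi y = phi (x^* * y).
  by rewrite rmorphM /= rmorph_star.
have V2s : (symbol phi).2^* * phi s = s.
  rewrite /symbol /= starD !(starM _ _^*) !starK mulrDl -!mulrA !phiM.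
  by rewrite sVs s1Vs rmorph1 raddf0 !mulr0 addr0 mulr1.
have V2s1 : (symbol phi).2^* * phi (u * s) = u * s.
  rewrite /symbol /= starD !(starM _ _^*) !starK mulrDl -!(mulrA _ _^*) !phiM.
  by rewrite sVs1 s1Vs1 rmorph1 raddf0 !mulr0 add0r mulr1.
split.
- by split.
- split=> //; apply: eq_on_isometries.
    by rewrite -mulrA symbol2_s V2s mul1r.
  by rewrite -mulrA symbol2_s1 V2s1 mul1r.
apply: eq_on_isometries.
  by rewrite -!mulrA Wu_s symbol2_s symbol2_s1 /= rmorphM.
rewrite -!mulrA Wu_s1 symbol2_s1 mulrA symbol2_s /= -!rmorphM.
by case: rel => _ _ -> _; rewrite expr2 mulrA.
Qed.

Definition of_end (phi : End Q2) : S_Q2 u s := SigSub (mem_set (symbol_S phi)).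

Lemma lambdaK : cancel lambda of_end.
Proof.
move=> p; apply: val_inj => /=; rewrite /symbol lambda_u lambda_s lambda_s1.
rewrite -!mulrA -mulrDr mulrA range_sum mulr1.
exact: esym (surjective_pairing _).
Qed.

Lemma of_endK : cancel of_end lambda.
Proof.
by move=> phi; apply: (Q2_ext hQ2); rewrite ?lambda_u ?lambda_s //= symbol2_s.
Qed.

Lemma end_compA : associative (@end_comp R Q2).
Proof. by move=> f g h; apply: (Q2_ext hQ2). Qed.

Lemma end_comp_id_l : left_id (end_id Q2) (@end_comp R Q2).
Proof. by move=> f; apply: (Q2_ext hQ2). Qed.

Lemma end_comp_id_r : right_id (end_id Q2) (@end_comp R Q2).
Proof. by move=> f; apply: (Q2_ext hQ2). Qed.

Lemma lambda_automorphism p : automorphism (lambda p) <->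
  range (lambda p) u /\ range (lambda p) (set_val p).2.
Proof.
split=> [[g gK Kg]|[[y _ phiy] [x _ phix]]].
  by split; [exists (g u)|exists (g (set_val p).2)].
have [_ [VVV _] _] := set_valP p.
have phixs : lambda p (x^* * s) = s.
  by rewrite rmorphM /= rmorph_star phix lambda_s mulrA VVV mul1r.
(* Injectivity serves twice: it pulls the relations back to the preimages of [u] and [s], and it
   makes the resulting right inverse two-sided. *)
have lambdaI : injective (lambda p) by exact: Q2_morphism_injective hQ2 _ _.
have rel' : Q2_relations y (x^* * s).
  by apply: (Q2_relations_reflect lambdaI); rewrite phiy phixs.
have E : star_comp (lambda p) (Q2_lift hQ2 rel') = end_id Q2
    :> starMorphism Q2 Q2.
  apply: (Q2_ext hQ2);
    by rewrite /= /star_comp ?Q2_lift_u ?Q2_lift_s ?phiy ?phixs.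
have K a : lambda p (Q2_lift hQ2 rel' a) = a.
  by have /= := congr1 (fun f : starMorphism Q2 Q2 => f a) E.
by exists (Q2_lift hQ2 rel') => a //; apply: lambdaI; rewrite K.
Qed.

End Endomorphisms.

Theorem theorem3p1 (R : realType) (Q2 : cstarAlgType R) (u s2 : Q2)
    (hQ2 : is_Q2 u s2) :
  exists Xi : S_Q2 u s2 -> End Q2,
  [/\ bijective Xi /\
      (forall (p : S_Q2 u s2) (phi : End Q2),
         is_lambda u s2 (set_val p).1 (set_val p).2 phi <-> phi = Xi p),
      exists (e : S_Q2 u s2) (mul : Monoid.law e),
        [/\ set_val e = (u, 1),
            Xi e = end_id Q2
          & forall p q : S_Q2 u s2, Xi (mul p q) = end_comp (Xi p) (Xi q)]
    & forall p : S_Q2 u s2,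
        automorphism (Xi p) <->
        range (Xi p) u /\ range (Xi p) (set_val p).2].
Proof.
exists (lambda hQ2); split; last exact: lambda_automorphism.
  split; last exact: is_lambdaP.
  by exists (of_end hQ2); [exact: lambdaK|exact: of_endK].
(* The product is transported from composition; for [p = (U, V)] and [q = (U', V')] it is the pair
   [lambda p U'], [lambda p V' * V]. *)
pose mul p q := of_end hQ2 (end_comp (lambda hQ2 p) (lambda hQ2 q)).
have mulA : associative mul.
  by move=> p q r; rewrite /mul !of_endK (end_compA hQ2).
have mul1 : left_id (of_end hQ2 (end_id Q2)) mul.
  by move=> p; rewrite /mul of_endK (end_comp_id_l hQ2) // lambdaK.
have mulr1 : right_id (of_end hQ2 (end_id Q2)) mul.
  by move=> p; rewrite /mul of_endK (end_comp_id_r hQ2) // lambdaK.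
pose mulL := HB.pack_for (Monoid.law (of_end hQ2 (end_id Q2))) mul
  (Monoid.isLaw.Build _ _ mul mulA mul1 mulr1).
exists (of_end hQ2 (end_id Q2)), mulL; split.
- rewrite /= /symbol /=; congr (_, _).
  by have [_ _ _] := hQ2.1; rewrite starM !mulrA.
- exact: of_endK.
- by move=> p q; exact: of_endK.
Qed.
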